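(* Let $\boldsymbol{P}$ be an M/G/1-type transition probability matrix (block form given in the context) with blocks $\{\boldsymbol{A}(k);k\ge -1\}$, $\{\boldsymbol{B}(k);k\ge -1\}$, and suppose that: (i) the stochastic matrix $\boldsymbol{P}$ is irreducible; (ii) $\boldsymbol{A}:=\sum_{k=-1}^\infty \boldsymbol{A}(k)$ is an irreducible stochastic matrix, with unique stationary distribution vector $\boldsymbol{\varpi}$; (iii) $\overline{\boldsymbol{m}}_B:=\sum_{k=1}^\infty k\boldsymbol{B}(k)\boldsymbol{e}<\infty$ (entrywise); (iv) $\sigma:=\boldsymbol{\varpi}\,\overline{\boldsymbol{m}}_A<0$, where $\overline{\boldsymbol{m}}_A=\sum_{k=-1}^\infty k\boldsymbol{A}(k)\boldsymbol{e}$. Suppose further that there exists a distribution function $F$ on $\mathbb{Z}_+$ that is long-tailed and satisfies $$\lim_{N\to\infty}\frac{\overline{\overline{\boldsymbol{A}}}(N)\boldsymbol{e}}{\overline{F}(N)}=\boldsymbol{c}_A,\qquad \lim_{N\to\infty}\frac{\overline{\overline{\boldsymbol{B}}}(N)\boldsymbol{e}}{\overline{F}(N)}=\boldsymbol{c}_B,$$ where $\boldsymbol{c}_A\ge\boldsymbol{0}$ and $\boldsymbol{c}_B\ge\boldsymbol{0}$ are $M_1$- and $M_0$-dimensional finite column vectors, respectively, at least one of which is non-zero. Let $\boldsymbol{\pi}$ be the unique stationary distribution vector of $\boldsymbol{P}$, let $\boldsymbol{\pi}^{(N)}$, $N\in\mathbb{N}$, be the stationary distribution vector of the level-increment truncation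 approximation $\boldsymbol{P}^{(N)}$, let $\overline{\boldsymbol{m}}_A^+=\sum_{k=1}^\infty k\boldsymbol{A}(k)\boldsymbol{e}$, and let $\overline{D}_I=1-D_I$, where $D_I$ is the integrated-tail distribution of the nonnegative level increment in steady state (defined in the context). Then, for every $k\in\mathbb{Z}_+$, $$\lim_{N\to\infty}\frac{\boldsymbol{\pi}^{(N)}(k)-\boldsymbol{\pi}(k)}{\overline{D}_I(N)}=\frac{\boldsymbol{\pi}(0)\overline{\boldsymbol{m}}_B+\overline{\boldsymbol{\pi}}(0)\overline{\boldsymbol{m}}_A^+}{-\sigma}\,\boldsymbol{\pi}(k)>\boldsymbol{0},$$ $$\lim_{N\to\infty}\frac{1}{\overline{D}_I(N)}\left\|\frac{\boldsymbol{\pi}^{(N)}(k)-\boldsymbol{\pi}(k)}{\boldsymbol{\pi}(k)\boldsymbol{e}}\right\|=\frac{\boldsymbol{\pi}(0)\overline{\boldsymbol{m}}_B+\overline{\boldsymbol{\pi}}(0)\overline{\boldsymbol{m}}_A^+}{-\sigma}>0,$$ where $\overline{\boldsymbol{\pi}}(0)=\sum_{\ell=1}^\infty\boldsymbol{\pi}(\ell)$.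
   Context: Notation. $\mathbb{Z}_+=\{0,1,2,\dots\}$, $\mathbb{N}=\{1,2,\dots\}$. $\boldsymbol{e}$ is the column vector of ones, $\boldsymbol{0}$ a zero vector, $\boldsymbol{O}$ a zero matrix (of appropriate sizes). Vector inequalities, limits and finiteness are entrywise. For a row vector $\boldsymbol{x}$, $\|\boldsymbol{x}\|=|\boldsymbol{x}|\boldsymbol{e}$ is the sum of the absolute values of its entries. M/G/1-type matrix. Fix $M_0,M_1\in\mathbb{N}$, $\mathbb{M}_0=\{1,\dots,M_0\}$, $\mathbb{M}_1=\{1,\dots,M_1\}$. The state space is $\mathbb{S}=\bigcup_{k=0}^\infty\{k\}\times\mathbb{M}_{\min(k,1)}$; level $k$ is $\mathbb{L}_k=\{k\}\times\mathbb{M}_{\min(k,1)}$. $\boldsymbol{P}$ is a stochastic matrix on $\mathbb{S}$ whose blocks (rows from $\mathbb{L}_k$, columns to $\mathbb{L}_\ell$) are: $(0,\ell)$-block $\boldsymbol{B}(\ell)$ for $\ell\ge0$; $(1,0)$-block $\boldsymbol{B}(-1)$; $(k,\ell)$-block $\boldsymbol{A}(\ell-k)$ for $k\ge1$, $\ell\ge 1$, $\ell\ge k-1$; all other blocks are $\boldsymbol{O}$. All blocks are nonnegative; $\boldsymbol{A}(k)$ is $M_1\times M_1$, $\boldsymbol{B}(0)$ is $M_0\times M_0$, $\boldsymbol{B}(-1)$ is $M_1\times M_0$, and $\boldsymbol{B}(k)$ is $M_0\times M_1$ for $k\ge1$. Under (i)--(iv), $\boldsymbol{P}$ is irreducible and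 positive recurrent, so it has a unique stationary distribution vector $\boldsymbol{\pi}$, partitioned by levels as $(\boldsymbol{\pi}(0),\boldsymbol{\pi}(1),\dots)$. Tail matrices. $\overline{\boldsymbol{A}}(k)=\sum_{\ell=k+1}^\infty\boldsymbol{A}(\ell)$, $\overline{\boldsymbol{B}}(k)=\sum_{\ell=k+1}^\infty\boldsymbol{B}(\ell)$, $\overline{\overline{\boldsymbol{A}}}(k)=\sum_{\ell=k+1}^\infty\overline{\boldsymbol{A}}(\ell)$, $\overline{\overline{\boldsymbol{B}}}(k)=\sum_{\ell=k+1}^\infty\overline{\boldsymbol{B}}(\ell)$ (for $k\ge 0$). Level-increment (LI) truncation. For $N\in\mathbb{N}$, $\boldsymbol{P}^{(N)}$ is the M/G/1-type stochastic matrix with the same block layout as $\boldsymbol{P}$ but with $\boldsymbol{A}(k),\boldsymbol{B}(k)$ replaced by $\boldsymbol{A}^{(N)}(k),\boldsymbol{B}^{(N)}(k)$, where $\boldsymbol{A}^{(N)}(k)=\boldsymbol{A}(k)$ for $-1\le k\le N-1$, $\boldsymbol{A}^{(N)}(N)=\overline{\boldsymbol{A}}(N-1)$, $\boldsymbol{A}^{(N)}(k)=\boldsymbol{O}$ for $k\ge N+1$, and likewise $\boldsymbol{B}^{(N)}(k)=\boldsymbol{B}(k)$ for $-1\le k\le N-1$, $\boldsymbol{B}^{(N)}(N)=\overline{\boldsymbol{B}}(N-1)$, $\boldsymbol{B}^{(N)}(k)=\boldsymbol{O}$ for $k\ge N+1$. $\boldsymbol{\pi}^{(N)}$ is a stationary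 distribution vector of $\boldsymbol{P}^{(N)}$ (a probability row vector with $\boldsymbol{\pi}^{(N)}\boldsymbol{P}^{(N)}=\boldsymbol{\pi}^{(N)}$), partitioned by levels. Long-tailed. $\overline{F}=1-F$. A distribution function $F$ on $\mathbb{Z}_+$ is long-tailed if $\overline{F}(k)>0$ for all $k\in\mathbb{Z}_+$ and $\lim_{k\to\infty}\overline{F}(k+n)/\overline{F}(k)=1$ for every $n\in\mathbb{Z}_+$. The distributions $D$ and $D_I$. Let $\{(X_n,J_n)\}$ be a Markov chain on $\mathbb{S}$ with transition matrix $\boldsymbol{P}$. The nonnegative level-increment-in-steady-state distribution is $$D(k)=\sum_{(\ell,i)\in\mathbb{S}}\pi(\ell,i)\,\mathbb{P}(\max(X_1-X_0,0)\le k\mid (X_0,J_0)=(\ell,i)),\quad k\in\mathbb{Z}_+,$$ and $D_I$ is its integrated-tail (equilibrium) distribution: $$D_I(k)=\frac{\sum_{\ell=0}^k(1-D(\ell))}{\sum_{\ell=0}^\infty(1-D(\ell))}=\sum_{\ell=0}^k\frac{\boldsymbol{\pi}(0)\overline{\boldsymbol{B}}(\ell)\boldsymbol{e}+\overline{\boldsymbol{\pi}}(0)\overline{\boldsymbol{A}}(\ell)\boldsymbol{e}}{\boldsymbol{\pi}(0)\overline{\boldsymbol{m}}_B+\overline{\boldsymbol{\pi}}(0)\overline{\boldsymbol{m}}_A^+},\quad k\in\mathbb{Z}_+.$$ *)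

(* Defs.v *)
From HB Require Import structures.
From mathcomp Require Import all_boot all_order all_algebra.
From mathcomp Require Import all_classical all_reals all_analysis.
Export numFieldNormedType.Exports.

Set Implicit Arguments.
Unset Strict Implicit.
Unset Printing Implicit Defensive.

Import Order.TTheory GRing.Theory Num.Theory.

Local Open Scope classical_set_scope.
Local Open Scope ring_scope.

(* Sums of real series; convergence is not part of the notation. *)
Notation "\sum_ ( m <= i <oo ) F" := (\big[+%R/0%R]_(m <= i <oo) F%R) : ring_scope.

Section MarkovMatrices.
Variables (R : realType) (T : choiceType).
Implicit Types (P : T -> T -> R) (p : T -> R).

Definition stochastic P : Prop :=
  (forall x y, 0 <= P x y) /\
  (forall x, \esum_(y in [set: T]) (P x y)%:E = 1%E).

Fixpoint nstep P (n : nat) (x y : T) : \bar R :=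
  if n is m.+1 then (\esum_(z in [set: T]) ((P x z)%:E * nstep P m z y))%E
  else ((x == y)%:R)%:E.

Definition irreducible P : Prop :=
  forall x y, exists n, (0 < nstep P n x y)%E.

Definition stationary_distribution P p : Prop :=
  [/\ forall x, 0 <= p x,
      \esum_(x in [set: T]) (p x)%:E = 1%E
    & forall y, \esum_(x in [set: T]) (p x * P x y)%:E = (p y)%:E].

End MarkovMatrices.

Section MG1.
Variables (R : realType) (M0 M1 : nat).

Definition phases (k : nat) : nat := if k is 0 then M0 else M1.

Definition state : Type := {k : nat & 'I_(phases k)}.
HB.instance Definition _ := Countable.on state.

Definition mkstate (k : nat) (i : 'I_(phases k)) : state := existT _ k i.

Definition level (s : state) : nat := projT1 s.

(* [blockA k] is meant for k >= -1 only: no definition below uses its values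
   at k < -1. The matrix B(k), k >= 0, has M0 rows and [phases k] columns,
   while B(-1) is M1 x M0. *)
Record MG1_blocks := MG1Blocks {
  blockA : int -> 'M[R]_M1;
  blockBm1 : 'M[R]_(M1, M0);
  blockB : forall k : nat, 'M[R]_(M0, phases k) }.

Implicit Type b : MG1_blocks.

Definition level_block b (k l : nat) : 'M[R]_(phases k, phases l) :=
  match k, l return 'M[R]_(phases k, phases l) with
  | 0, l => blockB b l
  | 1, 0 => blockBm1 b
  | _.+2, 0 => 0
  | k'.+1, l'.+1 =>
      if (k'.+1 <= l'.+2)%N then blockA b (l'.+1%:Z - k'.+1%:Z) else 0
  end.

Definition MG1_matrix b (s t : state) : R :=
  level_block b (projT1 s) (projT1 t) (projT2 s) (projT2 t).

Definition level_vec (p : state -> R) (k : nat) : 'rV[R]_(phases k) :=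
  \row_j p (mkstate j).

(* Series of matrices are entrywise. Those that are real-valued here converge
   under the standing assumptions on the chain; the mean vectors, whose
   finiteness is part of these assumptions, are extended real-valued. *)

Definition sumA b : 'M[R]_M1 :=
  \matrix_(i, j) \sum_(0 <= k <oo) blockA b (k%:Z - 1) i j.

Definition tailA b (k : nat) : 'M[R]_M1 :=
  \matrix_(i, j) \sum_(k.+1 <= l <oo) blockA b l%:Z i j.

(* B(l), l >= k + 1, is written B(l.+1), l >= k, so that it is M0 x M1. *)
Definition tailB b (k : nat) : 'M[R]_(M0, M1) :=
  \matrix_(i, j) \sum_(k <= l <oo) (blockB b l.+1 : 'M[R]_(M0, M1)) i j.

Definition tail2A b (k : nat) : 'M[R]_M1 :=
  \matrix_(i, j) \sum_(k.+1 <= l <oo) tailA b l i j.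

Definition tail2B b (k : nat) : 'M[R]_(M0, M1) :=
  \matrix_(i, j) \sum_(k.+1 <= l <oo) tailB b l i j.

Definition ones (n : nat) : 'cV[R]_n := const_mx 1.

Definition meanA b (i : 'I_M1) : \bar R :=
  (\sum_(0 <= k <oo)
     ((k%:R - 1) * (blockA b (k%:Z - 1)%R *m ones M1) i ord0)%R%:E)%E.

Definition meanA_plus b (i : 'I_M1) : \bar R :=
  (\sum_(1 <= k <oo) (k%:R * (blockA b k%:Z *m ones M1) i ord0)%R%:E)%E.

Definition meanB b (i : 'I_M0) : \bar R :=
  (\sum_(1 <= k <oo) (k%:R * (blockB b k *m ones (phases k)) i ord0)%R%:E)%E.

Definition drift b (varpi : 'rV[R]_M1) : \bar R :=
  (\sum_i (varpi ord0 i)%:E * meanA b i)%E.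

(* For N >= 1 only. *)
Definition LI_truncation (N : nat) b : MG1_blocks := MG1Blocks
  (fun k : int => if k < N%:Z then blockA b k
                  else if k == N%:Z then tailA b N.-1 else 0)
  (blockBm1 b)
  (fun k : nat => match k return 'M[R]_(M0, phases k) with
     | 0 => blockB b 0
     | k'.+1 => if (k'.+1 < N)%N then blockB b k'.+1
                else if k'.+1 == N then tailB b N.-1 else 0
     end).

(* The truncated subtraction of natural numbers is max(X_1 - X_0, 0), and the
   inner sum is the conditional probability that it is at most k given that
   (X_0, J_0) = s. *)
Definition increment_cdf b (p : state -> R) (k : nat) : R :=
  fine (\esum_(s in [set: state])
          ((p s)%:E *
           \esum_(t in [set t : state | (level t - level s <= k)%N])
              (MG1_matrix b s t)%:E))%E.

Definition integrated_tail (D : nat -> R) (k : nat) : R :=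
  (\sum_(0 <= l < k.+1) (1 - D l)) / (\sum_(0 <= l <oo) (1 - D l)).

Definition level_tail0 (p : state -> R) : 'rV[R]_M1 :=
  \row_j \sum_(0 <= l <oo) (level_vec p l.+1 : 'rV[R]_M1) ord0 j.

Definition mean_increment b (p : state -> R) : \bar R :=
  (\sum_i (level_vec p 0 ord0 i)%:E * meanB b i +
   \sum_j (level_tail0 p ord0 j)%:E * meanA_plus b j)%E.

End MG1.

Section Norm.
Variables (R : realType) (n : nat).

Definition norm1 (x : 'rV[R]_n) : R := \sum_j `|x ord0 j|.

End Norm.

Section LongTailed.
Variable R : realType.
Implicit Type F : nat -> R.

Definition distribution_function F : Prop :=
  [/\ 0 <= F 0%N,
      forall k, F k <= F k.+1
    & F n @[n --> \oo] --> (1 : R)].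

Definition long_tailed F : Prop :=
  (forall k, 0 < 1 - F k) /\
  (forall n, (1 - F (k + n)%N) / (1 - F k) @[k --> \oo] --> (1 : R)).

End LongTailed.

(* Main.v *)
(* Fix a state j and let sigma < 0 be the mean drift. There is a function
   H = level + beta, with beta bounded, such that
     (P - I) H = sigma - (sigma / pi(j)) 1_j:
   adding to the level a solution of the Poisson equation of the phase process
   gives drift exactly sigma off levels 0 and 1, and the finitely supported
   defect is removed by bounded Green functions of P killed at j.
   Since piN (PN - I) H = 0 for the truncated chain PN,
     - sigma (piN(j) - pi(j)) / pi(j) = piN (P - PN) H.
   The row PN(s, .) is P(s, .) with levels capped at level(s) + N, so
   (P - PN) H(s) is the mean excess r_N(s) = E_s (X_1 - X_0 - N)^+, up to an
   error O(r_N(s) - r_(N+1)(s)), which is negligible because the tail is long.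
   As r_N(s) is asymptotic to a multiple of 1 - F(N) that depends only on s,
   piN converges to pi, hence piN r_N and pi r_N are equivalent, and
   1 - D_I(N) = pi r_(N+1) / pi r_0 with pi r_0 the mean increment. *)
Require Import Defs.
From mathcomp Require Import all_boot all_order all_algebra.
From mathcomp Require Import all_classical all_reals all_analysis.
From mathcomp Require Import finmap ring lra zify.

Set Implicit Arguments.
Unset Strict Implicit.
Unset Printing Implicit Defensive.

Import Order.TTheory GRing.Theory Num.Theory.
Local Open Scope classical_set_scope.
Local Open Scope ring_scope.

(** The obstacle is integrability. Only first moments of the jumps are known to be finite, so the
    level may have infinite mean under pi, and pi (P - I) H = 0 cannot be obtained by subtracting pi
    H from pi P H. It holds because the mean absolute jump of H is bounded uniformly in the starting
    state. Nothing is known beforehand about the convergence of piN. The identity for piN(j) is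
    therefore used twice: first crudely, with the right-hand side O(1 - F(N)) because piN has mass
    one, which gives pointwise convergence; then sharply, after division by 1 - F(N). In between,
    pointwise convergence of probabilities is upgraded to convergence in l1, so that bounded
    functions varying with N can be integrated against piN. Uniformity in the state comes from r_N
    taking finitely many values: it depends only on the phase and on whether the level is zero.
    Killing at the very state j under study leaves a multiple of 1_j as the only defect, and this is
    what isolates piN(j). *)

Lemma cvgr_sum (R : realType) (I : Type) (r : seq I) (u : I -> nat -> R)
    (l : I -> R) : (forall i, u i n @[n --> \oo] --> l i) ->
  \sum_(i <- r) u i n @[n --> \oo] --> \sum_(i <- r) l i.
Proof.
move=> ul; elim: r => [|i r IHr].
  rewrite big_nil; under eq_fun do rewrite big_nil.
  exact: cvg_cst.
rewrite big_cons; under eq_fun do rewrite big_cons.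
exact: cvgD.
Qed.

(** * Real sums over arbitrary index types *)

Section RealSums.
Variables (R : realType) (T : choiceType).
Implicit Types (f g u v : T -> R).

Definition esumr f : \bar R := (\esum_(x in [set: T]) (f x)%:E)%E.

Definition summ f : Prop := (esumr (fun x => `|f x|%R) < +oo)%E.

(** Since [fine] sends +oo to 0, the value is meaningful only together with [summ f]. *)
Definition rsum f : R :=
  fine (esumr (fun x => Num.max (f x) 0)) -
  fine (esumr (fun x => Num.max (- f x) 0)).

Lemma esumr_ge0 f : (forall x, 0 <= f x) -> (0 <= esumr f)%E.
Proof. by move=> f0; apply: esum_ge0 => x _; rewrite lee_fin. Qed.

Lemma le_esumr f g : (forall x, f x <= g x) -> (esumr f <= esumr g)%E.
Proof. by move=> fg; apply: le_esum => x _; rewrite lee_fin. Qed.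

Lemma eq_esumr f g : f =1 g -> esumr f = esumr g.
Proof. by move=> /funext ->. Qed.

Lemma esumr0 : esumr (fun _ => 0) = 0%E.
Proof. by apply: esum1. Qed.

Lemma esumrD f g : (forall x, 0 <= f x) -> (forall x, 0 <= g x) ->
  esumr (fun x => f x + g x) = (esumr f + esumr g)%E.
Proof.
by move=> f0 g0; rewrite /esumr -esumD// => x _; rewrite lee_fin.
Qed.

Lemma esumr_fin_num f : (forall x, 0 <= f x) -> (esumr f < +oo)%E ->
  esumr f \is a fin_num.
Proof. by move=> f0 foo; rewrite ge0_fin_numE// esumr_ge0. Qed.

Lemma eq_summ f g : f =1 g -> summ f -> summ g.
Proof. by move=> /funext ->. Qed.

Lemma eq_rsum f g : f =1 g -> rsum f = rsum g.
Proof. by move=> /funext ->. Qed.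

Lemma summ_ge0 f : (forall x, 0 <= f x) -> (esumr f < +oo)%E -> summ f.
Proof.
by move=> f0; rewrite /summ (eq_esumr (g := f))// => x; rewrite ger0_norm.
Qed.

Lemma le_summ f g : (forall x, `|f x| <= g x) -> summ g -> summ f.
Proof.
move=> fg; apply: le_lt_trans; apply: le_esumr => x.
exact: le_trans (fg x) (ler_norm _).
Qed.

(** With a, b the positive and negative parts of [f], a + v = b + u pointwise, and this can be
    summed without any subtraction in the extended reals. Additivity of [rsum] rests on it. *)
Lemma rsum_diff f u v : (forall x, 0 <= u x) -> (forall x, 0 <= v x) ->
  (esumr u < +oo)%E -> (esumr v < +oo)%E -> (forall x, f x = u x - v x) ->
  rsum f = fine (esumr u) - fine (esumr v).
Proof.
move=> u0 v0 uoo voo fuv; rewrite /rsum.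
set a := fun x => Num.max (f x) 0; set b := fun x => Num.max (- f x) 0.
have a0 x : 0 <= a x by rewrite /a le_max lexx orbT.
have b0 x : 0 <= b x by rewrite /b le_max lexx orbT.
have aoo : (esumr a < +oo)%E.
  apply: le_lt_trans uoo; apply: le_esumr => x.
  by rewrite /a ge_max u0 fuv gerBl v0.
have boo : (esumr b < +oo)%E.
  apply: le_lt_trans voo; apply: le_esumr => x.
  by rewrite /b ge_max v0 fuv opprB gerBl u0.
have : (esumr a + esumr v = esumr b + esumr u)%E.
  rewrite -!esumrD//; apply: eq_esumr => x; rewrite /a /b fuv.
  by case: (lerP (u x - v x) 0) => ?; case: (lerP (- (u x - v x)) 0) => ?; lra.
rewrite -(fineK (esumr_fin_num a0 aoo)) -(fineK (esumr_fin_num b0 boo)).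
rewrite -(fineK (esumr_fin_num u0 uoo)) -(fineK (esumr_fin_num v0 voo)).
by rewrite -!EFinD => -[] /=; lra.
Qed.

Lemma rsum_esumr f : (forall x, 0 <= f x) -> (esumr f < +oo)%E ->
  rsum f = fine (esumr f).
Proof.
move=> f0 foo; rewrite (@rsum_diff f f (fun _ => 0))//.
- by rewrite esumr0 subr0.
- by rewrite esumr0 ltry.
- by move=> x; rewrite subr0.
Qed.

Lemma summ_esumr f : summ f -> (forall x, 0 <= f x) -> (esumr f < +oo)%E.
Proof.
by move=> sf f0; move: sf; rewrite /summ (eq_esumr (g := f))// => x; rewrite ger0_norm.
Qed.

Lemma rsumK f : (forall x, 0 <= f x) -> summ f -> (rsum f)%:E = esumr f.
Proof.
move=> f0 sf; have foo := summ_esumr sf f0.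
by rewrite rsum_esumr// fineK// esumr_fin_num.
Qed.

Lemma summ_sumr_eq f (v : R) : (forall x, 0 <= f x) -> esumr f = v%:E ->
  summ f /\ rsum f = v.
Proof.
move=> f0 fv; have foo : (esumr f < +oo)%E by rewrite fv ltry.
by split; [exact: summ_ge0 | rewrite rsum_esumr// fv].
Qed.

Lemma summD f g : summ f -> summ g -> summ (fun x => f x + g x).
Proof.
move=> sf sg; apply: (@le_lt_trans _ _ (esumr (fun x => `|f x| + `|g x|)%R)).
  by apply: le_esumr => x; exact: ler_normD.
by rewrite esumrD//; exact: lte_add_pinfty.
Qed.

Lemma esumrZ (c : R) f : 0 <= c -> (forall x, 0 <= f x) ->
  esumr (fun x => c * f x) = (c%:E * esumr f)%E.
Proof.
rewrite le_eqVlt => /predU1P[<- f0|c0 f0].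
  by rewrite mul0e -esumr0; apply: eq_esumr => x; rewrite mul0r.
have E X : (\sum_(x \in X) (c * f x)%:E = c%:E * \sum_(x \in X) (f x)%:E)%E.
  by rewrite ge0_mule_fsumr// => x; rewrite lee_fin.
apply/eqP; rewrite eq_le; apply/andP; split.
  apply: ge_ereal_sup => _ [X XT <-]; rewrite E.
  by rewrite lee_pmul2l//; apply: ereal_sup_ubound; exists X.
rewrite -lee_pdivlMl//.
apply: ge_ereal_sup => _ [X XT <-]; rewrite lee_pdivlMl// -E.
by apply: ereal_sup_ubound; exists X.
Qed.

Lemma summZ (c : R) f : summ f -> summ (fun x => c * f x).
Proof.
move=> sf; rewrite /summ (eq_esumr (g := fun x => `|c| * `|f x|)); last first.
  by move=> x; rewrite normrM.
by rewrite esumrZ//; apply: lte_mul_pinfty => //; rewrite lee_fin.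
Qed.

Lemma summN f : summ f -> summ (fun x => - f x).
Proof. by apply: le_lt_trans; apply: le_esumr => x; rewrite normrN. Qed.

Lemma summB f g : summ f -> summ g -> summ (fun x => f x - g x).
Proof. by move=> sf sg; apply: summD => //; exact: summN. Qed.

Lemma summ_norm f : summ f -> summ (fun x => `|f x|).
Proof. by apply: le_lt_trans; apply: le_esumr => x; rewrite normr_id. Qed.

Lemma summ_pos f : summ f -> (esumr (fun x => Num.max (f x) 0)%R < +oo)%E.
Proof.
apply: le_lt_trans; apply: le_esumr => x.
by rewrite ge_max normr_ge0 ler_norm.
Qed.

Lemma max0_ge0 (a : R) : 0 <= Num.max a 0.
Proof. by rewrite le_max lexx orbT. Qed.

Lemma max0E (a : R) : a = Num.max a 0 - Num.max (- a) 0.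
Proof. by case: (lerP a 0) => ?; case: (lerP (- a) 0) => ?; lra. Qed.

Lemma rsumD f g : summ f -> summ g ->
  rsum (fun x => f x + g x) = rsum f + rsum g.
Proof.
move=> sf sg.
have sfN := summN sf; have sgN := summN sg.
rewrite (@rsum_diff _ (fun x => Num.max (f x) 0 + Num.max (g x) 0)
    (fun x => Num.max (- f x) 0 + Num.max (- g x) 0)).
- rewrite !esumrD; do ?by move=> x; exact: max0_ge0.
  rewrite !fineD; try by apply: esumr_fin_num; [move=> x; exact: max0_ge0|exact: summ_pos].
  by rewrite /rsum; lra.
- by move=> x; rewrite addr_ge0// max0_ge0.
- by move=> x; rewrite addr_ge0// max0_ge0.
- rewrite esumrD; do ?by move=> x; exact: max0_ge0.
  by apply: lte_add_pinfty; exact: summ_pos.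
- rewrite esumrD; do ?by move=> x; exact: max0_ge0.
  by apply: lte_add_pinfty; exact: summ_pos.
- by move=> x; rewrite {1}(max0E (f x)) {1}(max0E (g x)); lra.
Qed.

Lemma rsumN f : rsum (fun x => - f x) = - rsum f.
Proof.
rewrite /rsum opprB; congr (_ - fine _).
by apply: eq_esumr => x; rewrite opprK.
Qed.

Lemma rsumB f g : summ f -> summ g ->
  rsum (fun x => f x - g x) = rsum f - rsum g.
Proof. by move=> sf sg; rewrite rsumD ?rsumN//; exact: summN. Qed.

Lemma rsum_ge0 f : (forall x, 0 <= f x) -> 0 <= rsum f.
Proof.
move=> f0; rewrite /rsum (eq_esumr (f := fun x => Num.max (- f x) 0) (g := fun=> 0)).
  by rewrite esumr0 subr0 fine_ge0// esumr_ge0// => x; exact: max0_ge0.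
by move=> x; apply/max_idPr; rewrite oppr_le0.
Qed.

Lemma ler_rsum f g : summ f -> summ g -> (forall x, f x <= g x) ->
  rsum f <= rsum g.
Proof.
move=> sf sg fg; rewrite -subr_ge0 -rsumB//; apply: rsum_ge0 => x.
by rewrite subr_ge0.
Qed.

Lemma ler_norm_rsum f : summ f -> `|rsum f| <= rsum (fun x => `|f x|).
Proof.
move=> sf; have sn := summ_norm sf; rewrite ler_norml -rsumN.
by apply/andP; split; apply: ler_rsum => //; try exact: summN; move=> x;
  rewrite ?ler_norm// lerNl -normrN ler_norm.
Qed.

Lemma rsum0 : rsum (fun _ => 0) = 0.
Proof.
rewrite rsum_esumr ?esumr0//; by rewrite ltry.
Qed.

Lemma summ0 : summ (fun _ => 0).
Proof. by apply: summ_ge0; rewrite ?esumr0 ?ltry. Qed.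

Lemma esumr_single (j : T) (c : R) : 0 <= c ->
  esumr (fun x => (x == j)%:R * c) = c%:E.
Proof.
move=> c0; rewrite /esumr (esumID [set j]); last first.
  by move=> x _; rewrite lee_fin mulr_ge0.
rewrite setTI esum_set1; last by rewrite eqxx mul1r lee_fin.
rewrite eqxx mul1r [X in (_ + X)%E]esum1 ?adde0// => x [_ /= /eqP xj].
by rewrite (negPf xj) mul0r.
Qed.

Lemma rsumZ_ge0 (c : R) f : 0 <= c -> summ f ->
  rsum (fun x => c * f x) = c * rsum f.
Proof.
move=> c0 sf; rewrite /rsum.
rewrite (eq_esumr (g := fun x => c * Num.max (f x) 0)); last first.
  by move=> x; rewrite maxr_pMr// mulr0.
rewrite (eq_esumr (f := fun x => Num.max (- _ ) 0)
                  (g := fun x => c * Num.max (- f x) 0)); last first.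
  by move=> x; rewrite maxr_pMr// mulr0 mulrN.
rewrite !esumrZ//; do ?by move=> x; exact: max0_ge0.
rewrite !fineM// ?mulrBr//; apply: esumr_fin_num; do ?by move=> x; exact: max0_ge0.
- exact/summ_pos/summN.
- exact/summ_pos.
Qed.

Lemma rsumZ (c : R) f : summ f -> rsum (fun x => c * f x) = c * rsum f.
Proof.
move=> sf; have [c0|c0] := leP 0 c; first exact: rsumZ_ge0.
rewrite -[c]opprK mulNr -rsumZ_ge0// ?oppr_ge0 1?ltW// -rsumN.
by apply: eq_rsum => x; rewrite mulNr.
Qed.

Lemma summ_single (j : T) (c : R) : summ (fun x => (x == j)%:R * c).
Proof.
apply: (@le_summ _ (fun x => (x == j)%:R * `|c|)).
  by move=> x; rewrite normrM normr_nat.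
by apply: summ_ge0; [move=> x; rewrite mulr_ge0|rewrite esumr_single// ltry].
Qed.

Lemma rsum_single (j : T) (h : T -> R) :
  rsum (fun x => (x == j)%:R * h x) = h j.
Proof.
transitivity (rsum (fun x => h j * ((x == j)%:R * 1))).
  by apply: eq_rsum => x; case: eqP => [->|_]; rewrite ?mul0r ?mulr0// mul1r !mulr1.
rewrite rsumZ; last exact: summ_single.
by rewrite rsum_esumr ?esumr_single ?mulr1// ltry.
Qed.

Lemma summ_term f x : (forall x, 0 <= f x) -> summ f -> f x <= rsum f.
Proof.
move=> f0 sf; rewrite -(rsum_single x f); apply: ler_rsum => //.
  apply: le_summ sf => y; case: eqP => _; rewrite ?mul1r ?mul0r ?normr0//.
  by rewrite ger0_norm.
by move=> y; case: eqP => _; rewrite ?mul1r ?mul0r.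
Qed.

Lemma rsum_seq_tail f (e : R) : (forall x, 0 <= f x) -> summ f -> 0 < e ->
  exists X : {fset T}, rsum (fun x => (x \notin X)%:R * f x) < e.
Proof.
move=> f0 sf e0.
have : (((rsum f) - e)%:E < esumr f)%E by rewrite -rsumK// lte_fin ltrBlDr ltrDl.
move=> /ereal_sup_gt[_ [X [finX _] <-]] H.
exists (fset_set X).
have sX : summ (fun x => (x \in fset_set X)%:R * f x).
  by apply: le_summ sf => y; case: (_ \in _); rewrite ?mul1r ?mul0r ?normr0// ger0_norm.
have sX' : summ (fun x => (x \notin fset_set X)%:R * f x).
  by apply: le_summ sf => y; case: (_ \in _); rewrite ?mul1r ?mul0r ?normr0// ger0_norm.
have E : rsum f = rsum (fun x => (x \in fset_set X)%:R * f x) +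
     rsum (fun x => (x \notin fset_set X)%:R * f x).
  rewrite -rsumD//; apply: eq_rsum => y.
  by case: (_ \in _); rewrite ?mul1r ?mul0r ?addr0 ?add0r.
suff : (\sum_(x \in X) (f x)%:E <= (rsum (fun x => (x \in fset_set X)%:R * f x))%:E)%E.
  move=> /(lt_le_trans H); rewrite lte_fin; lra.
rewrite rsumK//; last by move=> x; rewrite mulr_ge0.
rewrite (eq_fsbigr (fun x => ((x \in fset_set X)%:R * f x)%:E)); last first.
  by move=> x xX; rewrite in_fset_set// xX mul1r.
by apply: ereal_sup_ubound; exists X.
Qed.

Lemma rsum_fset (X : {fset T}) f :
  summ (fun x => (x \in X)%:R * f x) /\
  rsum (fun x => (x \in X)%:R * f x) = \sum_(x <- X) f x.
Proof.
have E x : (x \in X)%:R * f x = \sum_(y <- X) (x == y)%:R * f y.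
  have [xX|xX] := boolP (x \in X).
    rewrite (big_fsetD1 x)//= eqxx big1_seq ?addr0// => y /andP[_].
    by rewrite !inE eq_sym => /andP[/negPf-> _]; rewrite mul0r.
  rewrite mul0r big1_seq// => y /andP[_ yX]; case: eqP => [xy|]; rewrite ?mul0r//.
  by move: xX; rewrite xy yX.
rewrite (funext E); elim: (X : seq T) => [|y r [IHs IHr]].
  under eq_fun do rewrite big_nil.
  by rewrite big_nil; split; [exact: summ0|exact: rsum0].
under eq_fun do rewrite big_cons.
rewrite big_cons; split; first by apply: summD => //; exact: summ_single.
rewrite rsumD//; last exact: summ_single.
by rewrite IHr (@rsum_single y (fun=> f y)).
Qed.

(** Dominated convergence for the counting measure. A finite set [X] carries all but e/4 of [g]; off
    [X] the difference is at most 2 g, which costs less than e/2, and on [X] it is a finite sum of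
    null sequences. *)
Lemma rsum_dct (f_ : nat -> T -> R) f g : summ g ->
  (forall n x, `|f_ n x| <= g x) ->
  (forall x, f_ n x @[n --> \oo] --> f x) ->
  summ f /\ rsum (f_ n) @[n --> \oo] --> rsum f.
Proof.
move=> sg fg fcvg.
have g0 x : 0 <= g x by apply: le_trans (fg 0%N x).
have fg' x : `|f x| <= g x.
  have /(@cvg_norm _ R^o) H := fcvg x.
  rewrite -(cvg_lim _ H)//; apply: limr_le; first by apply/cvg_ex; eexists; exact: H.
  by apply: nearW => n; exact: fg.
have sf : summ f by apply: le_summ sg.
have sf_ n : summ (f_ n) by apply: le_summ sg.
split => //; apply/cvgrPdist_lt => e e0.
have e4 : 0 < e / 4%:R by rewrite divr_gt0.
have [X HX] := rsum_seq_tail g0 sg e4.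
have sX (h : T -> R) : summ h -> summ (fun x => (x \in X)%:R * h x).
  move=> /summ_norm sh; apply: le_summ sh => x.
  by rewrite normrM normr_nat; case: (_ \in _); rewrite ?mul1r ?mul0r.
have sXC (h : T -> R) : summ h -> summ (fun x => (x \notin X)%:R * h x).
  move=> /summ_norm sh; apply: le_summ sh => x.
  by rewrite normrM normr_nat; case: (_ \in _); rewrite ?mul1r ?mul0r.
have finX : \sum_(x <- X) `|f x - f_ n x| @[n --> \oo] --> 0.
  have := @cvgr_sum R _ X (fun x n => `|f x - f_ n x|) (fun=> 0).
  rewrite big1//; apply => x.
  rewrite -(@normr0 _ R) -[X in `|X|](subrr (f x)).
  apply: (@cvg_norm _ R^o); apply: cvgB => //; exact: cvg_cst.
near=> n.
have /(ler_norm_rsum)/le_lt_trans : summ (fun x => f x - f_ n x) by exact: summB.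
rewrite rsumB//; apply.
have sd : summ (fun x => `|f x - f_ n x|) by apply/summ_norm/summB.
rewrite (@eq_rsum _ (fun x => (x \in X)%:R * `|f x - f_ n x| +
    (x \notin X)%:R * `|f x - f_ n x|)); last first.
  by move=> x; case: (_ \in _); rewrite ?mul1r ?mul0r ?addr0 ?add0r.
rewrite rsumD//; [|exact: sX|exact: sXC].
have -> : rsum (fun x => (x \in X)%:R * `|f x - f_ n x|) = \sum_(x <- X) `|f x - f_ n x|.
  exact: (rsum_fset X _).2.
have H1 : \sum_(x <- X) `|f x - f_ n x| < e / 4%:R.
  near: n; move/cvgr0Pnorm_lt : finX => /(_ _ e4); apply: filterS => n.
  exact: le_lt_trans (ler_norm _).
have : rsum (fun x => (x \notin X)%:R * `|f x - f_ n x|) <=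
    rsum (fun x => 2%:R * ((x \notin X)%:R * g x)).
  apply: ler_rsum => [||x]; [exact: sXC|exact/summZ/sXC|].
  case: (_ \in _); rewrite ?mul0r ?mulr0// !mul1r.
  have := ler_normB (f x) (f_ n x); have := fg n x; have := fg' x; lra.
rewrite rsumZ; last exact: sXC.
lra.
Unshelve. all: by end_near. Qed.

End RealSums.

Lemma esumr_swap (R : realType) (T U : choiceType) (f : T -> U -> R) :
  (forall x y, 0 <= f x y) ->
  (\esum_(x in [set: T]) esumr (f x) =
   \esum_(y in [set: U]) esumr (fun x => f x y))%E.
Proof.
move=> f0; rewrite /esumr !esum_esum//; try by move=> *; rewrite lee_fin.
rewrite (reindex_esum ([set: U] `*`` (fun=> [set: T])) _ (fun z => (z.2, z.1)))//.
split=> //=; first by move=> [a b] [a' b'] _ _ [-> ->].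
by move=> [a b] _; exists (b, a).
Qed.

(** Fubini, from Tonelli applied to positive and negative parts. The row bounds [g] make the double
    sum of absolute values finite, and after swapping this makes every column summable too. *)
Lemma rsum_swap (R : realType) (T U : choiceType) (f : T -> U -> R) (g : T -> R) :
  (forall x, summ (f x)) -> (forall x, rsum (fun y => `|f x y|) <= g x) ->
  summ g ->
  rsum (fun x => rsum (f x)) = rsum (fun y => rsum (fun x => f x y)).
Proof.
move=> sf fg sg.
have fin x : (esumr (fun y => `|f x y|%R) < +oo)%E by exact: sf.
have tot : (\esum_(x in [set: T]) esumr (fun y => `|f x y|%R) < +oo)%E.
  apply: le_lt_trans sg; apply: le_esum => x _.
  rewrite -rsumK//; last exact/summ_norm.
  by rewrite lee_fin (le_trans (fg x) (ler_norm _)).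
have tot' := tot; rewrite esumr_swap// in tot'.
have pn (h : T -> U -> R) : (forall x y, 0 <= h x y <= `|f x y|) ->
   [/\ forall x, (esumr (h x) < +oo)%E, forall y, (esumr (fun x => h x y) < +oo)%E,
    (\esum_(x in [set: T]) esumr (h x) < +oo)%E &
    (\esum_(x in [set: T]) esumr (h x) = \esum_(y in [set: U]) esumr (fun x => h x y))%E].
  move=> hf; have h0 x y : 0 <= h x y by have /andP[] := hf x y.
  have hle x y : h x y <= `|f x y| by have /andP[] := hf x y.
  split; last exact: esumr_swap.
  - by move=> x; apply: le_lt_trans (fin x); apply: le_esumr.
  - move=> y; apply: le_lt_trans tot'.
    apply: (@le_trans _ _ (esumr (fun x => `|f x y|%R))); first exact: le_esumr.
    rewrite [leRHS](esumID [set y]); last by move=> ? _; exact: esumr_ge0.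
    rewrite setTI esum_set1 ?leeDl//; last exact: esumr_ge0.
    by apply: esum_ge0 => ? _; exact: esumr_ge0.
  - apply: le_lt_trans tot; apply: le_esum => x _; exact: le_esumr.
have [u1 u2 u3 u4] := pn (fun x y => Num.max (f x y) 0)
  (fun x y => ltac:(by rewrite max0_ge0 ge_max ler_norm normr_ge0)).
have [v1 v2 v3 v4] := pn (fun x y => Num.max (- f x y) 0)
  (fun x y => ltac:(by rewrite max0_ge0 ge_max -normrN ler_norm normr_ge0)).
have K (V W : choiceType) (h : V -> W -> R) : (forall x y, 0 <= h x y) ->
   (forall x, (esumr (h x) < +oo)%E) ->
   (esumr (fun x => fine (esumr (h x))) = \esum_(x in [set: V]) esumr (h x))%E.
  move=> h0 hoo; apply: eq_esum => x _; rewrite fineK// esumr_fin_num//.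
have m0 (a : R) := max0_ge0 a.
rewrite (@rsum_diff _ _ _ (fun x => fine (esumr (fun y => Num.max (f x y) 0)))
   (fun x => fine (esumr (fun y => Num.max (- f x y) 0))))//; last first.
- by rewrite K.
- by rewrite K.
- by move=> x; rewrite fine_ge0// esumr_ge0.
- by move=> x; rewrite fine_ge0// esumr_ge0.
rewrite (@rsum_diff _ _ _ (fun y => fine (esumr (fun x => Num.max (f x y) 0)))
   (fun y => fine (esumr (fun x => Num.max (- f x y) 0))))//; last first.
- by rewrite K// -v4.
- by rewrite K// -u4.
- by move=> x; rewrite fine_ge0// esumr_ge0.
- by move=> x; rewrite fine_ge0// esumr_ge0.
by rewrite !K// ?u4 ?v4.
Qed.

Lemma rsum_finType (R : realType) (T : finType) (f : T -> R) :
  summ f /\ rsum f = \sum_x f x.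
Proof.
have [sf rf] := rsum_fset [fset x | x in T]%fset f.
have E : (fun x => (x \in [fset x | x in T]%fset)%:R * f x) = f.
  by apply/funext => x; rewrite in_fset /= mul1r.
move: sf rf; rewrite E => ? ->; split => //.
by rewrite big_imfset//= big_enum.
Qed.

(** * Markov kernels: stationarity of unbounded functions, Poisson equation *)

Section Kernel.
Variables (R : realType) (T : choiceType) (Q : T -> T -> R).
Hypothesis Q_stoch : stochastic Q.
Implicit Types (f g : T -> R) (p : T -> R).

Definition mean f x : R := rsum (fun y => Q x y * f y).

(** The generator Q - I. The increment form is the one with uniform bounds in [x] for an unbounded
    [f] such as the level. *)
Definition gen f x : R := rsum (fun y => Q x y * (f y - f x)).

(** Summability is a separate clause because [rsum] of a non-summable nonnegative function is 0, so
    the numerical bound alone would say nothing. *)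
Definition jumps_le f (C : R) : Prop := forall x,
  summ (fun y => Q x y * (f y - f x)) /\
  rsum (fun y => Q x y * `|f y - f x|) <= C.

Let Q0 x y : 0 <= Q x y. Proof. by case: Q_stoch. Qed.

Lemma stoch_row x : summ (Q x) /\ rsum (Q x) = 1.
Proof. by case: Q_stoch => Q_ge0 Q_sum; exact: (summ_sumr_eq (Q_ge0 x) (Q_sum x)). Qed.

Lemma summ_mean f (M : R) x : (forall y, `|f y| <= M) ->
  summ (fun y => Q x y * f y).
Proof.
move=> fM; apply: (@le_summ _ _ _ (fun y => M * Q x y)).
  by move=> y; rewrite normrM ger0_norm// mulrC ler_wpM2r.
exact/summZ/(stoch_row x).1.
Qed.

Lemma mean_cst (c : R) x : mean (fun=> c) x = c.
Proof.
have [sQ Q1] := stoch_row x.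
rewrite -[RHS]mulr1 -Q1 -rsumZ//.
by apply: eq_rsum => y; rewrite mulrC.
Qed.

Lemma ler_mean f g (M M' : R) x : (forall y, `|f y| <= M) ->
  (forall y, `|g y| <= M') -> (forall y, f y <= g y) -> mean f x <= mean g x.
Proof.
move=> fM gM fg; apply: ler_rsum => [||y]; try by apply: summ_mean; eassumption.
by rewrite ler_wpM2l.
Qed.

Lemma mean_ge0 f x : (forall y, 0 <= f y) -> 0 <= mean f x.
Proof. by move=> f0; apply: rsum_ge0 => y; rewrite mulr_ge0. Qed.

Lemma ler_norm_mean f (M : R) x : (forall y, `|f y| <= M) -> `|mean f x| <= M.
Proof.
move=> fM; apply: le_trans (ler_norm_rsum (summ_mean x fM)) _.
have MM y : `|(`|f y|)| <= M by rewrite normr_id.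
rewrite (eq_rsum (g := fun y => Q x y * `|f y|)); last first.
  by move=> y; rewrite normrM ger0_norm.
rewrite -[leRHS](mean_cst M x).
exact: (@ler_mean _ (fun=> M) M `|M| x MM (fun=> lexx _) fM).
Qed.

Lemma gen_mean f (M : R) x : (forall y, `|f y| <= M) -> gen f x = mean f x - f x.
Proof.
move=> fM; rewrite /gen.
rewrite (eq_rsum (g := fun y => Q x y * f y - f x * Q x y)); last first.
  by move=> y; rewrite mulrBr [f x * _]mulrC.
have [sQ Q1] := stoch_row x.
rewrite rsumB ?rsumZ ?Q1 ?mulr1//; [exact: summ_mean fM|exact: summZ].
Qed.

Lemma jumps_le_bounded f (M : R) : (forall y, `|f y| <= M) -> jumps_le f (M + M).
Proof.
move=> fM x.
have dM y : `|f y - f x| <= M + M.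
  by rewrite (le_trans (ler_normB _ _))// lerD.
split; first exact: summ_mean dM.
have := @ler_norm_mean (fun y => `|f y - f x|) (M + M) x.
by move=> /(_ (fun y => ltac:(by rewrite normr_id))); apply: le_trans; exact: ler_norm.
Qed.

Lemma genD f g (C D : R) x : jumps_le f C -> jumps_le g D ->
  gen (fun y => f y + g y) x = gen f x + gen g x.
Proof.
move=> /(_ x)[sf _] /(_ x)[sg _]; rewrite /gen -rsumD//.
by apply: eq_rsum => y; rewrite -mulrDr opprD addrACA.
Qed.

Lemma summ_jumps f x : summ (fun y => Q x y * (f y - f x)) ->
  summ (fun y => Q x y * `|f y - f x|).
Proof.
move/summ_norm; apply: eq_summ => y; by rewrite normrM ger0_norm.
Qed.

Lemma jumps_leD f g (C D : R) : jumps_le f C -> jumps_le g D ->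
  jumps_le (fun y => f y + g y) (C + D).
Proof.
move=> Hf Hg x; have [sf fC] := Hf x; have [sg gD] := Hg x; split.
  have := summD sf sg; apply: eq_summ => y; by rewrite -mulrDr opprD addrACA.
have sf' := summ_jumps sf; have sg' := summ_jumps sg.
apply: le_trans (lerD fC gD); rewrite -rsumD//; apply: ler_rsum.
- have := summ_norm (summD sf sg); apply: eq_summ => y.
  by rewrite -mulrDr normrM ger0_norm// opprD addrACA.
- exact: summD.
- move=> y; rewrite -mulrDr ler_wpM2l// opprD addrACA; exact: ler_normD.
Qed.

Lemma gen_norm_le f (C : R) x : jumps_le f C -> `|gen f x| <= C.
Proof.
move=> /(_ x)[sf]; apply: le_trans; apply: le_trans (ler_norm_rsum sf) _.
rewrite le_eqVlt; apply/predU1P; left; apply: eq_rsum => y.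
by rewrite normrM ger0_norm.
Qed.

Lemma nstep_ge0 n x y : (0 <= nstep Q n x y)%E.
Proof.
elim: n x => [|n IHn] x /=; first by rewrite lee_fin.
by apply: esum_ge0 => u _; apply: mule_ge0; rewrite ?lee_fin.
Qed.

Section Stationary.
Variable p : T -> R.
Hypothesis p_stat : stationary_distribution Q p.

Lemma stat_ge0 x : 0 <= p x. Proof. by case: p_stat. Qed.

Lemma stat_sum : summ p /\ rsum p = 1.
Proof. by case: p_stat => p0 p1 _; exact: summ_sumr_eq. Qed.

Lemma stat_balance y : summ (fun x => p x * Q x y) /\ rsum (fun x => p x * Q x y) = p y.
Proof.
case: p_stat => p0 _ pQ; apply: summ_sumr_eq; last exact: pQ.
by move=> x; rewrite mulr_ge0.
Qed.

Lemma summ_stat f (M : R) : (forall y, `|f y| <= M) -> summ (fun y => p y * f y).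
Proof.
move=> fM; apply: (@le_summ _ _ _ (fun y => M * p y)).
  by move=> y; rewrite normrM (ger0_norm (stat_ge0 y)) mulrC ler_wpM2r ?stat_ge0.
exact/summZ/(stat_sum).1.
Qed.

Lemma stat_mean f (M : R) : (forall y, `|f y| <= M) ->
  rsum (fun x => p x * mean f x) = rsum (fun y => p y * f y).
Proof.
move=> fM.
transitivity (rsum (fun x => rsum (fun y => p x * (Q x y * f y)))).
  apply: eq_rsum => x; rewrite rsumZ//; exact: summ_mean fM.
rewrite (@rsum_swap _ _ _ _ (fun x => M * p x)).
- apply: eq_rsum => y; have [sy py] := stat_balance y.
  rewrite -py mulrC -rsumZ//; apply: eq_rsum => x; ring.
- by move=> x; apply: summZ; exact: summ_mean fM.
- move=> x; rewrite mulrC.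
  rewrite (eq_rsum (g := fun y => p x * (Q x y * `|f y|))); last first.
    by move=> y; rewrite !normrM (ger0_norm (stat_ge0 x)) (ger0_norm (Q0 x y)).
  have fM' y : `|(`|f y|)| <= M by rewrite normr_id.
  rewrite rsumZ; last exact: summ_mean fM'.
  rewrite ler_wpM2l ?stat_ge0//; have := ler_norm_mean x fM'; apply: le_trans.
  exact: ler_norm.
- exact/summZ/(stat_sum).1.
Qed.

(* Clipping is 1-Lipschitz, so the jump bound on [f] also dominates the jumps
   of the bounded functions [clip n \o f], to which [stat_mean] applies. *)
Definition clip (n : nat) (a : R) : R := Num.max (- n%:R) (Num.min a n%:R).

Lemma clip_lip n a b : `|clip n a - clip n b| <= `|a - b|.
Proof.
have minL (c u v : R) : `|Num.min u c - Num.min v c| <= `|u - v|.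
  have := ler_norm (v - u); rewrite (distrC v u); have := ler_norm (u - v).
  move: `|u - v| => d H1 H2; rewrite ler_norml.
  by case: (lerP u c) => ?; case: (lerP v c) => ?; apply/andP; split; lra.
have maxL (c u v : R) : `|Num.max c u - Num.max c v| <= `|u - v|.
  have := ler_norm (v - u); rewrite (distrC v u); have := ler_norm (u - v).
  move: `|u - v| => d H1 H2; rewrite ler_norml.
  by case: (lerP c u) => ?; case: (lerP c v) => ?; apply/andP; split; lra.
exact: le_trans (maxL _ _ _) (minL _ _ _).
Qed.

Lemma clip_norm n a : `|clip n a| <= n%:R.
Proof.
have n0 : - n%:R <= n%:R :> R by rewrite (@le_trans _ _ 0)// oppr_le0.
by rewrite ler_norml /clip le_max lexx ge_max n0 ge_min lexx orbT.
Qed.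

Lemma clip_cvg a : clip n a @[n --> \oo] --> a.
Proof.
apply: cvg_near_cst; near=> n.
have : `|a| <= n%:R by near: n; exact: nbhs_infty_ger.
by rewrite ler_norml => /andP[an na]; rewrite /clip (min_idPl na) (max_idPr an).
Unshelve. all: by end_near. Qed.

(** Two dominated convergences as the clipping level grows: along a row, dominated by the jumps of
    [f], then against [p], dominated by the constant [C]. This covers functions, like the level,
    that may fail to be integrable under [p]. *)
Lemma stat_gen f (C : R) : jumps_le f C -> rsum (fun x => p x * gen f x) = 0.
Proof.
move=> fC.
pose f_ n x := clip n (f x).
have fn n : rsum (fun x => p x * gen (f_ n) x) = 0.
  have fb x : `|f_ n x| <= n%:R by exact: clip_norm.
  rewrite (eq_rsum (g := fun x => p x * mean (f_ n) x - p x * f_ n x)).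
    rewrite rsumB; last 2 first.
    - by apply: (@summ_stat _ n%:R) => x; exact: ler_norm_mean.
    - exact: summ_stat fb.
    by rewrite (stat_mean fb) subrr.
  by move=> x; rewrite (gen_mean x fb) mulrBr.
have gx x : gen (f_ n) x @[n --> \oo] --> gen f x.
  have [sf _] := fC x.
  apply: (@rsum_dct _ _ _ _ _ (summ_jumps sf) _ _).2 => [n y|y].
    by rewrite normrM ger0_norm// ler_wpM2l// clip_lip.
  by apply: cvgMr; apply: cvgB; exact: clip_cvg.
have gC n x : `|gen (f_ n) x| <= C.
  have [sf] := fC x; apply: le_trans.
  have sfn : summ (fun y => Q x y * (f_ n y - f_ n x)).
    apply: (le_summ _ (summ_jumps sf)) => y.
    by rewrite normrM ger0_norm// ler_wpM2l// clip_lip.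
  apply: le_trans (ler_norm_rsum sfn) _; apply: ler_rsum.
  - exact: summ_norm.
  - exact: summ_jumps.
  - by move=> y; rewrite normrM ger0_norm// ler_wpM2l// clip_lip.
have [_] := @rsum_dct _ _ (fun n x => p x * gen (f_ n) x) (fun x => p x * gen f x)
  (fun x => C * p x) (summZ C stat_sum.1)
  (fun n x => ltac:(by rewrite normrM (ger0_norm (stat_ge0 x)) mulrC ler_wpM2r ?stat_ge0))
  (fun x => cvgMr (gx x)).
under eq_fun do rewrite fn.
by move=> /cvg_lim <- //; rewrite lim_cst.
Qed.

(** A zero of [p] propagates backwards along paths, since balance at z gives p(x) Q(x, z) <= p(z).
    By irreducibility it would reach every state, against total mass one. *)
Lemma stat_gt0 (Q_irr : irreducible Q) j : 0 < p j.
Proof.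
rewrite lt_neqAle stat_ge0 andbT; apply/eqP => pj0.
have key n x : (0 < nstep Q n x j)%E -> p x = 0.
  elim: n x => [|n IHn] x /=; first by case: eqP => [->|_]; rewrite // lte_fin ltxx.
  apply: contraPP => /eqP px.
  rewrite esum1 ?ltxx// => z _.
  have [->|Qxz] := eqVneq (Q x z) 0; first by rewrite mul0e.
  suff -> : nstep Q n z j = 0%E by rewrite mule0.
  apply/eqP; apply: contraT => nz.
  have pos : (0 < nstep Q n z j)%E.
    by rewrite lt_neqAle eq_sym nz nstep_ge0.
  have pz := IHn _ pos; have [sz bz] := stat_balance z.
  have := summ_term x (fun x => mulr_ge0 (stat_ge0 x) (Q0 x z)) sz.
  rewrite bz pz leNgt mulr_gt0// lt_neqAle eq_sym ?px ?stat_ge0//.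
  by rewrite Qxz Q0.
have [_ p1] := stat_sum.
have : rsum p = 0.
  rewrite -[RHS](@rsum0 R T); apply: eq_rsum => x.
  by have [n] := Q_irr x j; exact: key.
by rewrite p1 => /eqP; rewrite oner_eq0.
Qed.

End Stationary.

(** * Bounded Green functions of the chain killed at [j] *)

Section Green.
Hypothesis Q_irr : irreducible Q.
Variables j y : T.

(* [survival n x] is the probability, from [x], of avoiding [j] at times
   0, ..., n; [visits n x] is the expected number of visits to [y] at times
   0, ..., n - 1 and before the first visit to [j]. *)
Fixpoint survival n x : R :=
  (x != j)%:R * (if n is m.+1 then mean (survival m) x else 1).

Fixpoint visits n x : R :=
  if n is m.+1 then (x != j)%:R * ((x == y)%:R + mean (visits m) x) else 0.

Lemma survival_bounds n x : 0 <= survival n x <= 1.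
Proof.
elim: n x => [|n IHn] x /=; first by rewrite mulr1; case: eqP => _ /=; rewrite ?lexx ler01.
have s0 z : 0 <= survival n z by have /andP[] := IHn z.
have s1 z : `|survival n z| <= 1 by have /andP[? ?] := IHn z; rewrite ger0_norm.
have m0 := mean_ge0 x s0; have := ler_norm_mean x s1; rewrite ger0_norm// => m1.
by case: eqP => _ /=; rewrite ?mul0r ?mul1r ?lexx ?ler01// m0.
Qed.

(** Avoiding [j] up to time [n] and sitting at [j] at time [n] are disjoint events. This is how
    irreducibility yields a survival probability below 1. *)
Lemma survival_nstep n x : ((survival n x)%:E + nstep Q n x j <= 1)%E.
Proof.
elim: n x => [|n IHn] x /=.
  by rewrite mulr1 -EFinD lee_fin; case: eqP => _ /=; rewrite ?addr0 ?add0r.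
have s0 z : 0 <= survival n z by have /andP[] := survival_bounds n z.
have s1 z : `|survival n z| <= 1.
  by have /andP[? ?] := survival_bounds n z; rewrite ger0_norm.
apply: (@le_trans _ _ ((mean (survival n) x)%:E +
    \esum_(z in [set: T]) ((Q x z)%:E * nstep Q n z j))%E).
  apply: leeD => //; rewrite lee_fin.
  have := mean_ge0 x s0.
  by case: eqP => _ /=; rewrite ?mul0r ?mul1r.
rewrite rsumK//; last exact: summ_mean s1.
  rewrite /esumr -esumD; last 2 first.
  - by move=> z _; rewrite lee_fin mulr_ge0.
  - by move=> z _; rewrite mule_ge0 ?lee_fin// nstep_ge0.
  case: Q_stoch => _ /(_ x) <-; apply: le_esum => z _.
  by rewrite EFinM -ge0_muleDr ?nstep_ge0 ?lee_fin// -[leRHS]mule1 lee_wpmul2l ?lee_fin.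
by move=> z; rewrite mulr_ge0.
Qed.

Lemma visits_bounds n x : 0 <= visits n x <= n%:R.
Proof.
elim: n x => [|n IHn] x /=; first by rewrite lexx.
have s0 z : 0 <= visits n z by have /andP[] := IHn z.
have s1 z : `|visits n z| <= n%:R by have /andP[? ?] := IHn z; rewrite ger0_norm.
have m0 := mean_ge0 x s0; have := ler_norm_mean x s1; rewrite ger0_norm// => m1.
case: eqP => _ /=; rewrite ?mul0r ?mul1r ?lexx ?ler0n// addr_ge0//=.
by rewrite -natr1 addrC lerD//; case: eqP.
Qed.

Lemma visits_ge0 n x : 0 <= visits n x.
Proof. by have /andP[] := visits_bounds n x. Qed.

Lemma visits_norm n x : `|visits n x| <= n%:R.
Proof. by rewrite ger0_norm; have /andP[] := visits_bounds n x. Qed.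

Lemma visits_nondecreasing n x : visits n x <= visits n.+1 x.
Proof.
elim: n x => [|n IHn] x; first by rewrite visits_ge0.
rewrite [leLHS]/= [leRHS]/= ler_wpM2l// lerD2l.
by apply: (ler_mean x (visits_norm n) (visits_norm n.+1)).
Qed.

Lemma visits_homo x : {homo visits^~ x : n m / (n <= m)%N >-> n <= m}.
Proof.
apply: homo_leq => // [? ? ?|n]; first exact: le_trans.
exact: visits_nondecreasing.
Qed.

(** Maximum principle: away from [y] the count is zero or an average of counts with a shorter
    horizon, so the induction ends at [y], where monotonicity in the horizon applies. *)
Lemma visits_max n N x : (n <= N)%N -> visits n x <= visits N y.
Proof.
elim: n x => [|n IHn] x nN; first by rewrite visits_ge0.
have [->|xy] := eqVneq x y; first exact: visits_homo.
rewrite /= (negPf xy) add0r; case: eqP => _ /=.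
  by rewrite mul0r visits_ge0.
rewrite mul1r.
have b z : `|visits n z| <= visits N y by rewrite ger0_norm ?visits_ge0// IHn// ltnW.
by have := ler_norm_mean x b; apply: le_trans; exact: ler_norm.
Qed.

(** Markov property at time [m]: at most one visit is counted at each of the first [m] times, and at
    most [G] afterwards, provided that [j] has been avoided so far. *)
Lemma visits_survival n m (G : R) x : (forall z, visits n z <= G) ->
  visits (m + n) x <= m%:R + G * survival m x.
Proof.
move=> gG; have G0 : 0 <= G by apply: le_trans (gG j); exact: visits_ge0.
elim: m x => [|m IHm] x /=.
  rewrite add0n add0r mulr1; case: eqP => [->|_] /=; last by rewrite mulr1.
  by rewrite mulr0; case: n {gG} => //= n; rewrite eqxx mul0r.
have [xj|xj] := eqVneq x j; first by rewrite !mul0r mulr0 addr0.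
rewrite !mul1r -natr1.
suff : mean (visits (m + n)) x <= m%:R + G * mean (survival m) x.
  have : (x == y)%:R <= 1 :> R by case: (x == y).
  by move=> ? ?; lra.
have s1 z : `|survival m z| <= 1.
  by have /andP[? ?] := survival_bounds m z; rewrite ger0_norm.
have b z : `|m%:R + G * survival m z| <= m%:R + G.
  have /andP[s0 s1'] := survival_bounds m z.
  rewrite ger0_norm ?addr_ge0 ?mulr_ge0// lerD2l.
  by rewrite -[leRHS]mulr1 ler_wpM2l.
apply: le_trans (ler_mean x (visits_norm _) b IHm) _.
rewrite /mean (eq_rsum (g := fun z => Q x z * m%:R + G * (Q x z * survival m z))).
  rewrite rsumD.
  - rewrite -/(mean _ _) mean_cst rsumZ//; exact: summ_mean s1.
  - by apply: (@summ_mean (fun=> m%:R) m%:R) => z; rewrite ger0_norm.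
  - apply: summZ; exact: summ_mean s1.
by move=> z; ring.
Qed.

Lemma visits_bounded : exists B : R, forall n x, visits n x <= B.
Proof.
have [m hm] := Q_irr y j.
pose s := survival m y.
have s1 : s < 1.
  have := survival_nstep m y; rewrite -/s => H.
  by rewrite -lte_fin; apply: lt_le_trans H; rewrite lteDl.
exists (m%:R / (1 - s)) => n x.
apply: le_trans (visits_max x (leq_addl m n)) _.
(* The maximum G = [visits (m + n) y] is itself an admissible bound, so the inequality closes up: G
   <= m + s G, hence G <= m / (1 - s) whatever [n]. *)
have := @visits_survival n m (visits (m + n) y) y
  (fun z => visits_max z (leq_addl m n)).
rewrite -/s ler_pdivlMr; [lra|by rewrite subr_gt0].
Qed.

(** The limit of [visits] solves g = 1_y + Q g off [j] and vanishes at [j]. The constant [c] records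
    the failure of the equation there, which is why it equals [mean g j + (j == y)%:R]. *)
Lemma green_function : exists (g : T -> R) (B c : R),
  (forall x, `|g x| <= B) /\
  (forall x, gen g x = c * (x == j)%:R - (x == y)%:R).
Proof.
have [B vB] := visits_bounded.
have vB' n x : `|visits n x| <= B by rewrite ger0_norm ?visits_ge0.
pose g x := lim (visits n x @[n --> \oo]).
have cg x : visits n x @[n --> \oo] --> g x.
  apply/cvg_ex; exists (sup (range (visits^~ x))).
  apply: nondecreasing_cvgn; first exact: visits_homo.
  by exists B => _ [n _ <-].
have gB x : `|g x| <= B.
  have /(@cvg_norm _ R^o) H := cg x.
  rewrite -(cvg_lim _ H)//; apply: limr_le; first by apply/cvg_ex; eexists; exact: H.
  by apply: nearW => n; exact: vB'.
have mg x : mean (visits n) x @[n --> \oo] --> mean g x.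
  apply: (@rsum_dct _ _ _ _ (fun z => B * Q x z) (summZ B (stoch_row x).1) _ _).2.
    by move=> n z; rewrite normrM ger0_norm// mulrC ler_wpM2r.
  by move=> z; apply: cvgMr; exact: cg.
have gE x : g x = (x != j)%:R * ((x == y)%:R + mean g x).
  have H1 : visits n.+1 x @[n --> \oo] --> g x by rewrite (cvg_shiftS (visits^~ x)).
  have H2 : visits n.+1 x @[n --> \oo] --> (x != j)%:R * ((x == y)%:R + mean g x).
    by apply: cvgMr; apply: cvgD; [exact: cvg_cst|exact: mg].
  exact: (cvg_unique _ H1 H2).
exists g, B, (mean g j + (j == y)%:R); split => // x.
rewrite (gen_mean x gB) [X in _ - X]gE.
have [->|xj] := eqVneq x j; rewrite /=; ring.
Qed.

End Green.

(** One Green function per point of the support [K]. The coefficient [c] is left unspecified: each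
    application identifies it afterwards by integrating against a stationary distribution. *)
Lemma poisson_solution (Q_irr : irreducible Q) (K : seq T) (psi : T -> R) j :
  (forall x, x \notin K -> psi x = 0) ->
  exists (h : T -> R) (B c : R), (forall x, `|h x| <= B) /\
    (forall x, gen h x = c * (x == j)%:R - psi x).
Proof.
elim: K psi => [|y K IHK] psi psiK.
  exists (fun=> 0), 0, 0; split=> [x|x]; first by rewrite normr0.
  rewrite psiK// mul0r subr0 -[RHS](@rsum0 R T).
  by apply: eq_rsum => z; rewrite subr0 mulr0.
have [|h [B [c [hB hE]]]] := IHK (fun x => psi x - psi y * (x == y)%:R).
  move=> x xK; have [->|xy] := eqVneq x y; first by rewrite mulr1 subrr.
  by rewrite psiK ?mulr0 ?subrr// inE negb_or xy.
have [g [B' [c' [gB gE]]]] := green_function Q_irr j y.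
have gB' x : `|psi y * g x| <= `|psi y| * B' by rewrite normrM ler_wpM2l.
exists (fun x => h x + psi y * g x), (B + `|psi y| * B'), (c + psi y * c').
split=> x; first by rewrite (le_trans (ler_normD _ _))// lerD.
rewrite (genD x (jumps_le_bounded hB) (jumps_le_bounded gB')) hE.
suff -> : gen (fun x => psi y * g x) x = psi y * gen g x by rewrite gE; ring.
rewrite /gen -rsumZ; last by have [] := jumps_le_bounded gB x.
by apply: eq_rsum => z; ring.
Qed.

End Kernel.

(** * Series over levels and M/G/1-type rows *)

Section NatSums.
Variable R : realType.
Implicit Types (f : nat -> R).

Lemma nneseries_esumr f (m : nat) : (forall k, (m <= k)%N -> 0 <= f k) ->
  (\sum_(m <= k <oo) (f k)%:E)%E = esumr (fun k => f (k + m)%N).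
Proof.
move=> f0; pose g k := if (m <= k)%N then f k else 0.
have g0 k : (0 <= (g k)%:E)%E.
  by rewrite lee_fin /g; case: ifPn => // /f0.
transitivity (\sum_(m <= k <oo) (g k)%:E)%E.
  apply: congr_lim; apply/funext => n; apply: eq_big_nat => k /andP[mk _].
  by rewrite /g mk.
rewrite -nneseries_addn// nneseries_esumT; last by move=> k; exact: g0.
by apply: eq_esumr => k; rewrite /g leq_addl.
Qed.

Lemma esumr_nat_split f (n : nat) : (forall k, 0 <= f k) ->
  esumr f = ((\sum_(k < n) f k)%:E + esumr (fun k => f (k + n)%N))%E.
Proof.
move=> f0.
have -> : esumr f = (\sum_(0 <= k <oo) (f k)%:E)%E.
  by rewrite nneseries_esumr//; apply: eq_esumr => k; rewrite addn0.
rewrite (@nneseries_split _ (fun k => (f k)%:E) 0 n); last first.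
  by move=> k _; rewrite lee_fin.
by rewrite add0n nneseries_esumr// sumEFin big_mkord.
Qed.

Lemma esumr_nat_drop f (n : nat) : (forall k, 0 <= f k) ->
  (forall k, (k < n)%N -> f k = 0) -> esumr f = esumr (fun k => f (k + n)%N).
Proof.
move=> f0 fn; rewrite (esumr_nat_split n f0) big1 ?add0e// => k _.
exact: fn.
Qed.

Lemma series_rsum f (m : nat) : (forall k, (m <= k)%N -> 0 <= f k) ->
  summ (fun k => f (k + m)%N) ->
  \sum_(m <= k <oo) f k = rsum (fun k => f (k + m)%N).
Proof.
move=> f0 sf.
have fm0 k : 0 <= f (k + m)%N by rewrite f0// leq_addl.
apply: cvg_lim => //.
have H : (\sum_(m <= k < n) (f k)%:E)%E @[n --> \oo] --> (rsum (fun k => f (k + m)%N))%:E.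
  rewrite rsumK// -nneseries_esumr//.
  by apply: is_cvg_nneseries => k mk _; rewrite lee_fin f0.
move: H; under eq_fun do rewrite sumEFin.
by move=> /fine_cvgP[_].
Qed.

Lemma esumr_nat_indic (n : nat) (c : R) : 0 <= c ->
  esumr (fun l => (l < n)%:R * c) = (n%:R * c)%:E.
Proof.
move=> c0; rewrite (esumr_nat_split n); last by move=> k; rewrite mulr_ge0.
rewrite (eq_esumr (g := fun=> 0)); last first.
  by move=> k; rewrite ltnNge leq_addl mul0r.
rewrite esumr0 adde0; congr EFin.
under eq_bigr do rewrite ltn_ord mul1r.
by rewrite sumr_const card_ord mulr_natl.
Qed.

(* Double tails count the term [a m] once for each [l] with [N < l <= m]. *)
Lemma double_tail (a : nat -> R) (N : nat) : (forall m, 0 <= a m) ->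
  esumr (fun m => (m - N)%:R * a m) =
  (\esum_(l in [set: nat]) esumr (fun m => a (m + (l + N.+1))%N))%E.
Proof.
move=> a0.
transitivity (\esum_(l in [set: nat]) esumr (fun m => (l < m - N)%:R * a m)%R)%E.
  rewrite esumr_swap; last by move=> l m; rewrite mulr_ge0.
  by apply: eq_esum => m _; rewrite esumr_nat_indic.
apply: eq_esum => l _; rewrite (@esumr_nat_drop _ (l + N.+1)%N).
- apply: eq_esumr => m; rewrite (_ : (l < _)%N = true) ?mul1r//; lia.
- by move=> m; rewrite mulr_ge0.
- move=> m ml; rewrite (_ : (l < _)%N = false) ?mul0r//; lia.
Qed.

End NatSums.

Lemma esumr_sum (R : realType) (T : choiceType) (I : finType) (f : I -> T -> R) :
  (forall i x, 0 <= f i x) ->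
  esumr (fun x => \sum_i f i x) = (\sum_i esumr (f i))%E.
Proof.
move=> f0; rewrite /esumr -esum_sum; last by move=> *; rewrite lee_fin.
by apply: eq_esum => x _; rewrite sumEFin.
Qed.

Lemma rsum_sum (R : realType) (T : choiceType) (I : finType) (f : I -> T -> R) :
  (forall i, summ (f i)) ->
  summ (fun x => \sum_i f i x) /\ rsum (fun x => \sum_i f i x) = \sum_i rsum (f i).
Proof.
move=> sf; elim: (index_enum I) => [|i s [IHs IHr]].
  under eq_fun do rewrite big_nil.
  by rewrite big_nil; split; [exact: summ0|exact: rsum0].
under eq_fun do rewrite big_cons.
by rewrite big_cons; split; [exact: summD|rewrite rsumD// IHr].
Qed.

Section Levels.
Variables (R : realType) (M0 M1 : nat).
Local Notation state := (state M0 M1).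
Implicit Types (f phi : state -> R).

Lemma esumr_level f : (forall s, 0 <= f s) ->
  esumr f = esumr (fun k => \sum_(i < phases M0 M1 k) f (mkstate i)).
Proof.
move=> f0; pose F k := [set s : state | level s = k].
have F0 s : (0 <= (f s)%:E)%E by rewrite lee_fin.
transitivity (\esum_(s in \bigcup_k F k) (f s)%:E)%E.
  congr (esum _ _); apply/seteqP; split=> // s _; by exists (level s).
rewrite nneseries_sum_bigcup//; last first.
  by move=> k l _ _ [s []]; rewrite /F /= => -> ->.
rewrite nneseries_esumT; last by move=> k; apply: esum_ge0.
apply: eq_esum => k _.
rewrite (reindex_esum [set: 'I_(phases M0 M1 k)] (F k) (@mkstate M0 M1 k)).
  have [sf rf] := rsum_finType (fun i : 'I_(phases M0 M1 k) => f (mkstate i)).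
  by rewrite -rf rsumK// => i; exact: f0.
split=> //.
- move=> i j _ _ /eqP; rewrite /mkstate eq_Tagged => /eqP //.
- by move=> [l i]; rewrite /F /= => <-; exists i.
Qed.

(** Upward jumps have the same law from all positive levels, so functions built from them depend on
    the level only through its being zero or not. They take finitely many values, whence uniform
    bounds. *)
Definition by_kind (u : 'I_M0 -> R) (v : 'I_M1 -> R) (s : state) : R :=
  match s with existT k i =>
    (match k return 'I_(phases M0 M1 k) -> R with 0 => u | _.+1 => v end) i
  end.

Lemma by_kind_bounded u v s : `|by_kind u v s| <= \sum_i `|u i| + \sum_j `|v j|.
Proof.
case: s => [[|k] i] /=.
  by rewrite (bigD1 i)//= -addrA lerDl addr_ge0// sumr_ge0.
by rewrite [X in _ + X](bigD1 i)//= addrCA lerDl addr_ge0// sumr_ge0.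
Qed.

(* The cap is at level [n.+1], not [n]: phases are only kept within levels >= 1. *)
Definition cap (n : nat) (s : state) : state :=
  match s with existT k i =>
    (match k return 'I_(phases M0 M1 k) -> state with
     | 0 => fun i => @mkstate M0 M1 0 i
     | l.+1 => fun i => @mkstate M0 M1 (minn l n).+1 i
     end) i
  end.

Lemma level_cap n s : level (cap n s) = minn (level s) n.+1.
Proof. by case: s => [[|l] i] //=; rewrite /level /= minnSS. Qed.

Lemma cap_id n s : (level s <= n.+1)%N -> cap n s = s.
Proof. by case: s => [[|l] i] //=; rewrite /level /= ltnS => /minn_idPl ->. Qed.

Lemma cap_mk n m (i : 'I_M1) : (n <= m)%N ->
  cap n (@mkstate M0 M1 m.+1 i) = @mkstate M0 M1 n.+1 i.
Proof. by move=> /minn_idPr /= ->. Qed.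

End Levels.

Section Blocks.
Variables (R : realType) (M0 M1 : nat) (b : MG1_blocks R M0 M1).
Local Notation state := (state M0 M1).
Local Notation P := (MG1_matrix b).

(** Counted from a jump of one level ([m] stands for a rise by [m.+1]): the target level is then
    positive, so [j] has type ['I_M1] from every state and level 0 needs no separate treatment. *)
Definition up (s : state) (m : nat) (j : 'I_M1) : R :=
  by_kind (fun i => (blockB b m.+1 : 'M[R]_(M0, M1)) i j)
          (fun i => blockA b m.+1%:Z i j) s.

Lemma MG1_up s m (j : 'I_M1) :
  P s (@mkstate M0 M1 (level s + m).+1 j) = up s m j.
Proof.
case: s => [[|[|k]] i] //=; rewrite /MG1_matrix /level /up /=.
rewrite ifT; last lia.
by congr (blockA b _ i j); lia.
Qed.

Lemma MG1_down s t : (level t + 1 < level s)%N -> P s t = 0.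
Proof.
case: s => [[|[|k]] i]; case: t => [[|l] j] //; rewrite /level /= => kl; try lia.
  by rewrite /MG1_matrix /= mxE.
rewrite /MG1_matrix /= ifF ?mxE//; lia.
Qed.

(** Rows from level 2 on contain the whole sequence A(-1), A(0), ...; at level 1 the downward block
    is B(-1) instead. *)
Lemma MG1_full k (i : 'I_M1) n (j : 'I_M1) :
  P (@mkstate M0 M1 k.+2 i) (@mkstate M0 M1 (n + k).+1 j) = blockA b (n%:Z - 1) i j.
Proof.
rewrite /MG1_matrix /= ifT; last lia.
by congr (blockA b _ i j); lia.
Qed.

End Blocks.

Lemma esumr_shift_le (R : realType) (a : nat -> R) (n : nat) :
  (forall m, 0 <= a m) -> (esumr (fun m => a (m + n)%N) <= esumr a)%E.
Proof.
move=> a0; rewrite [leRHS](esumr_nat_split n)// leeDr// lee_fin.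
by rewrite sumr_ge0.
Qed.

Lemma summ_shift (R : realType) (a : nat -> R) (n : nat) :
  (forall m, 0 <= a m) -> summ a -> summ (fun m => a (m + n)%N).
Proof.
move=> a0 sa; apply: summ_ge0 => //.
exact: le_lt_trans (esumr_shift_le n a0) (summ_esumr sa a0).
Qed.

Lemma double_tail_rsum (R : realType) (a : nat -> R) (N : nat) :
  (forall m, 0 <= a m) -> summ (fun m => m.+1%:R * a m) ->
  [/\ summ a, summ (fun l => rsum (fun m => a (m + (l + N.+1))%N)) &
    rsum (fun m => (m - N)%:R * a m) =
    rsum (fun l => rsum (fun m => a (m + (l + N.+1))%N))].
Proof.
move=> a0 sma.
have sa : summ a.
  apply: le_summ sma => m; rewrite ger0_norm// -[leLHS]mul1r ler_wpM2r//.
  by rewrite ler1n.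
have smN : summ (fun m => (m - N)%:R * a m).
  apply: le_summ sma => m; rewrite ger0_norm ?mulr_ge0// ler_wpM2r// ler_nat; lia.
have E := double_tail N a0.
have E' : (\esum_(l in [set: nat]) esumr (fun m => a (m + (l + N.+1))%N))%E =
    esumr (fun l => rsum (fun m => a (m + (l + N.+1))%N)).
  by apply: eq_esum => l _; rewrite rsumK//; exact: summ_shift.
rewrite E' -rsumK// in E; last by move=> m; rewrite mulr_ge0.
have r0 l : 0 <= rsum (fun m => a (m + (l + N.+1))%N) by apply: rsum_ge0.
by have [? <-] := summ_sumr_eq r0 (esym E).
Qed.

Section MG1Rows.
Variables (R : realType) (M0 M1 : nat) (b : MG1_blocks R M0 M1).
Local Notation state := (state M0 M1).
Local Notation P := (MG1_matrix b).
Hypothesis P_stoch : stochastic P.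
Implicit Types (phi : state -> R) (s t : state).

Let P0 s t : 0 <= P s t. Proof. by case: P_stoch. Qed.

Lemma up_ge0 s m (j : 'I_M1) : 0 <= up b s m j.
Proof. by rewrite -MG1_up. Qed.

Lemma blockA_ge0 n (i j : 'I_M1) : 0 <= blockA b (n%:Z - 1) i j.
Proof. by rewrite -(MG1_full b 0 i). Qed.

Lemma row_up s phi : (forall t, 0 <= phi t) ->
  (forall t, (level t <= level s)%N -> phi t = 0) ->
  esumr (fun t => P s t * phi t) =
  esumr (fun m => \sum_j up b s m j * phi (@mkstate M0 M1 (level s + m).+1 j)).
Proof.
move=> phi0 phis; rewrite esumr_level; last by move=> t; rewrite mulr_ge0.
set g := fun k => _.
rewrite (@esumr_nat_drop _ g (level s).+1).
- apply: eq_esumr => m; rewrite addnS addnC /g; apply: eq_bigr => j _.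
  by rewrite MG1_up.
- by move=> k; rewrite /g sumr_ge0// => i _; rewrite mulr_ge0.
- by move=> k ks; rewrite /g big1// => i _; rewrite phis ?mulr0.
Qed.

Lemma row_full k (i : 'I_M1) phi : (forall t, 0 <= phi t) ->
  esumr (fun t => P (@mkstate M0 M1 k.+2 i) t * phi t) =
  esumr (fun n => \sum_j blockA b (n%:Z - 1) i j * phi (@mkstate M0 M1 (n + k).+1 j)).
Proof.
move=> phi0; rewrite esumr_level; last by move=> t; rewrite mulr_ge0.
set g := fun k => _.
rewrite (@esumr_nat_drop _ g k.+1).
- apply: eq_esumr => n; rewrite addnS /g; apply: eq_bigr => j _.
  by rewrite MG1_full.
- by move=> l; rewrite /g sumr_ge0// => j _; rewrite mulr_ge0.
- move=> l ks; rewrite /g big1// => j _; rewrite MG1_down ?mul0r//.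
  by rewrite /level /=; lia.
Qed.

Lemma rsum_row_full k (i : 'I_M1) phi :
  summ (fun t => P (@mkstate M0 M1 k.+2 i) t * phi t) ->
  rsum (fun t => P (@mkstate M0 M1 k.+2 i) t * phi t) =
  rsum (fun n => \sum_j blockA b (n%:Z - 1) i j * phi (@mkstate M0 M1 (n + k).+1 j)).
Proof.
set s := mkstate _ => sphi.
have E phi' : (fun t => Num.max (P s t * phi' t) 0) =
    (fun t => P s t * Num.max (phi' t) 0).
  by apply/funext => t; rewrite maxr_pMr// mulr0.
have p0 : forall phi' t, 0 <= Num.max (phi' t) (0 : R) by move=> *; exact: max0_ge0.
have B phi' n : 0 <= \sum_j blockA b (n%:Z - 1) i j *
    Num.max (phi' (@mkstate M0 M1 (n + k).+1 j)) 0.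
  by rewrite sumr_ge0// => j _; rewrite mulr_ge0// blockA_ge0.
symmetry; rewrite /rsum.
rewrite E (_ : (fun t => Num.max (- (P s t * phi t)) 0) =
    fun t => P s t * Num.max (- phi t) 0); last first.
  by rewrite -(E (fun t => - phi t)); apply/funext => t; rewrite mulrN.
rewrite -/(rsum _) (rsum_diff (B phi) (B (fun t => - phi t))).
- by rewrite !row_full//; exact: p0.
- by rewrite -(@row_full _ _ (fun t => Num.max (phi t) 0))// -E; exact: summ_pos.
- rewrite -(@row_full _ _ (fun t => Num.max (- phi t) 0)); last first.
    by move=> t; exact: max0_ge0.
  rewrite -(E (fun t => - phi t)).
  by have := summN sphi; under eq_fun do rewrite -mulrN; exact: summ_pos.
- move=> n; rewrite -sumrB; apply: eq_bigr => j _.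
  by rewrite -mulrBr -max0E.
Qed.

Definition excess (N : nat) s t : R := (level t - level s - N)%:R.

Definition mean_excess N s : R := rsum (fun t => P s t * excess N s t).

Definition jump_mass s m : R := \sum_j up b s m j.

Lemma jump_mass_ge0 s m : 0 <= jump_mass s m.
Proof. by rewrite sumr_ge0// => j _; exact: up_ge0. Qed.

Lemma esumr_excess N s :
  esumr (fun t => P s t * excess N s t) =
  esumr (fun m => (m.+1 - N)%:R * jump_mass s m).
Proof.
rewrite row_up// => [|t ts]; last by rewrite /excess (_ : (_ - _ - _)%N = 0%N)//; lia.
apply: eq_esumr => m; rewrite /jump_mass mulr_sumr; apply: eq_bigr => j _.
rewrite mulrC /excess; congr (_%:R * _); rewrite /level /=; lia.
Qed.

Hypothesis jumps_finite : forall s,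
  (esumr (fun m => m.+1%:R * jump_mass s m)%R < +oo)%E.

Lemma summ_excess N s : summ (fun t => P s t * excess N s t).
Proof.
apply: summ_ge0; first by move=> t; rewrite mulr_ge0.
rewrite esumr_excess; apply: le_lt_trans (jumps_finite s).
apply: le_esumr => m; rewrite ler_wpM2r ?jump_mass_ge0// ler_nat; lia.
Qed.

Lemma mean_excess_ge0 N s : 0 <= mean_excess N s.
Proof. by apply: rsum_ge0 => t; rewrite mulr_ge0. Qed.

Lemma mean_excess_homo s N N' : (N <= N')%N -> mean_excess N' s <= mean_excess N s.
Proof.
move=> NN'; apply: ler_rsum => [||t]; try exact: summ_excess.
by rewrite ler_wpM2l// ler_nat; lia.
Qed.

Lemma summ_up_moment s (j : 'I_M1) : summ (fun m => m.+1%:R * up b s m j).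
Proof.
apply: summ_ge0 => [m|]; first by rewrite mulr_ge0// up_ge0.
apply: le_lt_trans (jumps_finite s); apply: le_esumr => m.
rewrite ler_wpM2l// /jump_mass (bigD1 j)//= lerDl sumr_ge0// => ? _; exact: up_ge0.
Qed.

(** The definitions index the two tails differently, B(l.+1) with l >= k against A(l) with l > k;
    expressed through [up] they agree. *)
Lemma tail_up s N (j : 'I_M1) :
  by_kind (fun i => tailB b N i j) (fun i => tailA b N i j) s =
  rsum (fun m => up b s (m + N) j).
Proof.
have [sa _ _] := double_tail_rsum 0 (fun m => up_ge0 s m j) (summ_up_moment s j).
have := summ_shift N (fun m => up_ge0 s m j) sa.
have u0 m := up_ge0 s m j.
case: s {sa} u0 => [[|k] i] /= u0 sa; rewrite mxE.
  by rewrite series_rsum.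
pose f l := blockA b l%:Z i j.
have fE : (fun m => f (m + N.+1)%N) = fun m => up b (@mkstate M0 M1 k.+1 i) (m + N) j.
  by apply/funext => m; rewrite addnS.
rewrite (@series_rsum _ f) ?fE//.
by move=> [//|l] _; exact: u0.
Qed.

Lemma tail2_up s N (j : 'I_M1) :
  by_kind (fun i => tail2B b N i j) (fun i => tail2A b N i j) s =
  rsum (fun m => (m - N)%:R * up b s m j).
Proof.
have [_ st ->] := double_tail_rsum N (fun m => up_ge0 s m j) (summ_up_moment s j).
pose f l := by_kind (fun i => tailB b l i j) (fun i => tailA b l i j) s.
have fE : (fun l => f (l + N.+1)%N) =
    fun l => rsum (fun m => up b s (m + (l + N.+1)) j).
  by apply/funext => l; rewrite /f tail_up.
have f0 l : 0 <= f l.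
  by rewrite /f tail_up rsum_ge0// => m; exact: up_ge0.
rewrite -fE -series_rsum ?fE// /f.
by case: (s) => [[|k] i] /=; rewrite mxE.
Qed.

(** The block A(k) enters [tail2A b N] once for each l with N < l < k, that is (k - N - 1)^+ times,
    and likewise for B; hence the shift from [N] to [N.+1]. *)
Lemma mean_excessS N s : mean_excess N.+1 s =
  by_kind (fun i => (tail2B b N *m ones R M1) i ord0)
          (fun i => (tail2A b N *m ones R M1) i ord0) s.
Proof.
transitivity (\sum_j by_kind (fun i => tail2B b N i j) (fun i => tail2A b N i j) s);
  last first.
  by case: s => [[|k] i] /=; rewrite [RHS]mxE; apply: eq_bigr => j _; rewrite [X in _ * X]mxE mulr1.
under eq_bigr do rewrite tail2_up.
have sj j : summ (fun m => (m - N)%:R * up b s m j).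
  apply: le_summ (summ_up_moment s j) => m.
  rewrite ger0_norm ?mulr_ge0 ?up_ge0// ler_wpM2r ?up_ge0// ler_nat; lia.
have [ss <-] := rsum_sum sj.
have e0 t : 0 <= P s t * excess N.+1 s t by rewrite mulr_ge0.
have s0 m : 0 <= \sum_j (m - N)%:R * up b s m j.
  by rewrite sumr_ge0// => j _; rewrite mulr_ge0 ?up_ge0.
rewrite /mean_excess rsum_esumr//; last exact: summ_esumr (summ_excess _ _) e0.
rewrite esumr_excess rsum_esumr//; last exact: summ_esumr.
congr fine; apply: eq_esumr => m; rewrite subSS /jump_mass mulr_sumr.
by [].
Qed.

Lemma mean_excess0 s : (mean_excess 0 s)%:E = esumr (fun m => m.+1%:R * jump_mass s m).
Proof.
rewrite /mean_excess rsumK ?esumr_excess//; last exact: summ_excess.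
by move=> t; rewrite mulr_ge0.
Qed.

(** For an integer x, (x - N)^+ - (x - N - 1)^+ is the indicator of x > N. This serves both for the
    tail of D and for the error caused by truncation. *)
Lemma mean_excess_step N s :
  summ (fun t => P s t * (level s + N < level t)%:R) /\
  rsum (fun t => P s t * (level s + N < level t)%:R) =
  mean_excess N s - mean_excess N.+1 s.
Proof.
have E : (fun t => P s t * (level s + N < level t)%:R) =
    (fun t => P s t * excess N s t - P s t * excess N.+1 s t).
  apply/funext => t; rewrite -mulrBr /excess; congr (_ * _).
  case: ltnP => h.
    rewrite (_ : level t - level s - N = (level t - level s - N.+1).+1)%N; last lia.
    by rewrite -natr1 addrC addKr.
  have -> : (level t - level s - N.+1)%N = 0%N by lia.
  have -> : (level t - level s - N)%N = 0%N by lia.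
  by rewrite subrr.
rewrite E; split; first by apply: summB; exact: summ_excess.
by rewrite rsumB//; exact: summ_excess.
Qed.

Definition lev s : R := (level s)%:R.

(** The chain descends at most one level per step, so an absolute jump is at most the excess plus
    1. *)
Lemma lev_jumps (C : R) : (forall s, mean_excess 0 s <= C) -> jumps_le P lev (C + 1).
Proof.
move=> eC s; have [sP P1] := stoch_row P_stoch s.
have sD := summD (summ_excess 0 s) sP.
have le t : P s t * `|lev t - lev s| <= P s t * excess 0 s t + P s t.
  have [ts|ts] := ltnP (level t + 1) (level s).
    by rewrite MG1_down// !mul0r addr0.
  rewrite (_ : _ + P s t = P s t * (excess 0 s t + 1)); last by rewrite mulrDr mulr1.
  rewrite ler_wpM2l// /lev /excess subn0.
  have [h|h] := leqP (level s) (level t).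
    by rewrite natrB// ger0_norm ?subr_ge0 ?ler_nat// lerDl.
  rewrite (_ : level s = (level t).+1); last lia.
  by rewrite distrC -natr1 addrAC subrr add0r normr1 lerDr.
split.
  by apply: le_summ sD => t; rewrite normrM ger0_norm.
apply: le_trans (_ : rsum (fun t => P s t * excess 0 s t + P s t) <= _).
  apply: ler_rsum => //; apply: le_summ sD => t.
  by rewrite ger0_norm// mulr_ge0.
by rewrite rsumD//; [rewrite P1 lerD2r; exact: eC|exact: summ_excess].
Qed.

Definition down_mass (i : 'I_M1) : R := \sum_j blockA b (- 1) i j.

Lemma gen_lev k (i : 'I_M1) :
  gen P lev (@mkstate M0 M1 k.+2 i) =
  mean_excess 0 (@mkstate M0 M1 k.+2 i) - down_mass i.
Proof.
set s := mkstate _.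
pose dn t : R := (level s - level t)%:R.
have dn0 t : 0 <= dn t by [].
have dnE : esumr (fun t => P s t * dn t) = (down_mass i)%:E.
  rewrite row_full//.
  rewrite (eq_esumr (g := fun n => (n == 0%N)%:R * down_mass i)).
    by rewrite esumr_single// sumr_ge0// => j _; exact: (blockA_ge0 0).
  move=> [|n].
    rewrite mul1r; apply: eq_bigr => j _.
    by rewrite /dn /level /= (_ : (_ - _)%N = 1%N) ?mulr1//; lia.
  rewrite mul0r big1// => j _.
  by rewrite /dn /level /= (_ : (_ - _)%N = 0%N) ?mulr0//; lia.
have [sdn rdn] := summ_sumr_eq (fun t => mulr_ge0 (P0 s t) (dn0 t)) dnE.
rewrite /gen -rdn -rsumB//; last exact: summ_excess.
apply: eq_rsum => t; rewrite -mulrBr; congr (_ * _).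
rewrite /lev /excess /dn subn0; have [h|h] := leqP (level s) (level t).
  have -> : (level s - level t)%N = 0%N by lia.
  by rewrite natrB// subr0.
have -> : (level t - level s)%N = 0%N by lia.
by rewrite natrB ?sub0r ?opprB// ltnW.
Qed.

(** The total mass 1 of a row from level 2 bounds the series of every entry. *)
Lemma summ_blockA (i j : 'I_M1) :
  summ (fun n => blockA b (n%:Z - 1) i j) /\
  rsum (fun n => blockA b (n%:Z - 1) i j) = sumA b i j.
Proof.
have sA : summ (fun n => blockA b (n%:Z - 1) i j).
  apply: summ_ge0 => [n|]; first exact: blockA_ge0.
  have := @row_full 0 i (fun=> 1) (fun=> ler01).
  have [_ /(_ (@mkstate M0 M1 2 i)) P1] := P_stoch.
  rewrite (eq_esumr (g := P (@mkstate M0 M1 2 i))); last by move=> t; rewrite mulr1.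
  rewrite [esumr _]P1 => E.
  apply: (@le_lt_trans _ _ 1%E); last exact: ltry.
  rewrite E; apply: le_esumr => n.
  rewrite (bigD1 j)//= mulr1 lerDl sumr_ge0// => l _.
  by rewrite mulr1 blockA_ge0.
split => //; rewrite mxE (@series_rsum _ (fun n => blockA b (n%:Z - 1) i j)).
- by apply: eq_rsum => n; rewrite addn0.
- by move=> n _; exact: blockA_ge0.
- by apply: eq_summ sA => n; rewrite addn0.
Qed.

(** From level 2 on a step cannot reach level 0, so [a] is read at every target, and summing out the
    jump size leaves the phase kernel A. *)
Lemma gen_phase k (i : 'I_M1) (a : 'I_M1 -> R) :
  gen P (by_kind (fun=> 0) a) (@mkstate M0 M1 k.+2 i) = gen (sumA b) a i.
Proof.
set a' := by_kind _ _; set s := mkstate _.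
have [sg _] := jumps_le_bounded P_stoch (by_kind_bounded (fun=> 0) a) s.
rewrite /gen (rsum_row_full (phi := fun t => a' t - a' s))//.
have sj j : summ (fun n => blockA b (n%:Z - 1) i j * (a j - a i)).
  have [/(summZ (a j - a i)) + _] := summ_blockA i j.
  by apply: eq_summ => n; rewrite mulrC.
have [_ ->] := rsum_sum sj; have [_ ->] := rsum_finType (fun j => sumA b i j * (a j - a i)).
apply: eq_bigr => j _; have [sA <-] := summ_blockA i j.
rewrite mulrC -rsumZ//; apply: eq_rsum => n; exact: mulrC.
Qed.

End MG1Rows.

(** * Level-increment truncation *)

Section LITruncation.
Variables (R : realType) (M0 M1 : nat) (b : MG1_blocks R M0 M1).
Local Notation state := (state M0 M1).
Local Notation P := (MG1_matrix b).
Hypothesis P_stoch : stochastic P.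
Hypothesis jumps_finite : forall s,
  (esumr (fun m => m.+1%:R * jump_mass b s m)%R < +oo)%E.
Variable N : nat.
Local Notation PN := (MG1_matrix (LI_truncation N.+1 b)).
Implicit Types (phi : state -> R) (s t : state).

Let P0 s t : 0 <= P s t. Proof. by case: P_stoch. Qed.

Lemma LI_lt s t : (level t < level s + N.+1)%N -> PN s t = P s t.
Proof.
case: s => [[|[|k]] i]; case: t => [[|l] j] //; rewrite /level /= => kl;
  rewrite /MG1_matrix /=.
- by rewrite ifT//; lia.
- by rewrite ifT//; lia.
- by case: ifP => // kl'; rewrite ifT//; lia.
Qed.

Lemma LI_gt s t : (level s + N.+1 < level t)%N -> PN s t = 0.
Proof.
case: s => [[|[|k]] i]; case: t => [[|l] j] //; rewrite /level /= => kl;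
  rewrite /MG1_matrix /=; try lia.
- by rewrite ifF ?ifF ?mxE//; lia.
- by rewrite ifF ?ifF ?mxE//; lia.
- by case: ifP => kl'; rewrite ?mxE//; rewrite ifF ?ifF ?mxE//; lia.
Qed.

Lemma LI_eq s (j : 'I_M1) : PN s (@mkstate M0 M1 (level s + N).+1 j) =
  rsum (fun m => up b s (m + N) j).
Proof.
rewrite -(tail_up P_stoch jumps_finite).
case: s => [[|[|k]] i]; rewrite /MG1_matrix /level /=.
- by rewrite ifF ?ifT//; lia.
- by rewrite ifF ?ifT//; lia.
- rewrite ifT; last lia.
  rewrite ifF; last lia.
  by rewrite ifT//; apply/eqP; lia.
Qed.

(* [PN s] is the image of [P s] under capping at level [level s + N.+1]. *)
Lemma row_LI s phi : (forall t, 0 <= phi t) ->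
  esumr (fun t => PN s t * phi t) =
  esumr (fun t => P s t * phi (cap (level s + N) t)).
Proof.
move=> phi0; set n := (level s + N)%N.
have u0 m j := up_ge0 P_stoch s m j.
have su j : summ (fun m => up b s (m + N) j).
  apply: (@summ_shift _ (fun m => up b s m j)) => //.
  by have [] := double_tail_rsum 0 (u0 ^~ j) (summ_up_moment P_stoch jumps_finite s j).
have PN0 t : 0 <= PN s t.
  case: (ltngtP (level t) (level s + N.+1)%N) => h.
  - by rewrite LI_lt.
  - by rewrite LI_gt.
  case: t h => [[|l] j] h; first by move: (h : 0%N = (level s + N.+1)%N); lia.
  have {h}-> : l = (level s + N)%N by move: (h : l.+1 = (level s + N.+1)%N); lia.
  by rewrite LI_eq rsum_ge0.
pose X k := \sum_(i < phases M0 M1 k) PN s (mkstate i) * phi (mkstate i).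
pose Y k := \sum_(i < phases M0 M1 k) P s (mkstate i) * phi (cap n (mkstate i)).
have X0 k : 0 <= X k by rewrite sumr_ge0// => i _; rewrite mulr_ge0.
have Y0 k : 0 <= Y k by rewrite sumr_ge0// => i _; rewrite mulr_ge0.
rewrite esumr_level; last by move=> t; rewrite mulr_ge0.
rewrite [RHS]esumr_level; last by move=> t; rewrite mulr_ge0.
rewrite -/X -/Y (esumr_nat_split n.+1 X0) (esumr_nat_split n.+1 Y0).
congr (_%:E + _)%E.
  apply: eq_bigr => k _; apply: eq_bigr => i _.
  have kn := ltn_ord k; rewrite cap_id; last by rewrite /level /= ltnW.
  by rewrite LI_lt// /level /= addnS.
have -> : esumr (fun k => X (k + n.+1)%N) = (X n.+1)%:E.
  rewrite -(@esumr_single _ _ 0%N)//; apply: eq_esumr => -[|k].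
    by rewrite add0n mul1r.
  rewrite mul0r /X big1// => i _; rewrite LI_gt ?mul0r// {2}/level /=.
  by rewrite /n; lia.
have -> : X n.+1 = \sum_j phi (@mkstate M0 M1 n.+1 j) * rsum (fun m => up b s (m + N) j).
  by apply: eq_bigr => j _; rewrite mulrC LI_eq.
rewrite -sumEFin.
transitivity (esumr (fun k => \sum_j phi (@mkstate M0 M1 n.+1 j) * up b s (k + N) j)).
  rewrite esumr_sum; last by move=> i x; rewrite mulr_ge0.
  by apply: eq_bigr => j _; rewrite EFinM rsumK// esumrZ.
apply: eq_esumr => k; rewrite addnS /Y; apply: eq_bigr => j _.
rewrite cap_mk ?leq_addl// mulrC; congr (_ * _).
by rewrite -MG1_up /n addnCA.
Qed.

Lemma LI_stoch : stochastic PN.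
Proof.
have PN1 s : esumr (PN s) = 1%E.
  have := @row_LI s (fun=> 1) (fun=> ler01).
  under eq_fun do rewrite mulr1; move=> ->; under eq_fun do rewrite mulr1.
  by case: P_stoch => _ /(_ s).
split; last exact: PN1.
move=> s t; case: (ltngtP (level t) (level s + N.+1)%N) => h.
- by rewrite LI_lt.
- by rewrite LI_gt.
case: t h => [[|l] j] h; first by move: (h : 0%N = (level s + N.+1)%N); lia.
have {h}-> : l = (level s + N)%N by move: (h : l.+1 = (level s + N.+1)%N); lia.
by rewrite LI_eq rsum_ge0// => m; exact: up_ge0.
Qed.

Lemma rsum_row_LI s phi :
  rsum (fun t => PN s t * phi t) = rsum (fun t => P s t * phi (cap (level s + N) t)).
Proof.
have [PN0 _] := LI_stoch.
have E Q phi' : (forall t, 0 <= Q s t) ->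
    (fun t => Num.max (Q s t * phi' t) 0) = (fun t => Q s t * Num.max (phi' t) (0 : R)).
  by move=> Q0; apply/funext => t; rewrite maxr_pMr// mulr0.
rewrite /rsum !E//; under [in X in _ - X = _]eq_fun do rewrite -mulrN.
under [in X in _ = _ - X]eq_fun do rewrite -mulrN.
rewrite !E// (row_LI s (phi := fun t => Num.max (phi t) 0)); last first.
  by move=> t; exact: max0_ge0.
rewrite (row_LI s (phi := fun t => Num.max (- phi t) 0))//.
by move=> t; exact: max0_ge0.
Qed.

Section LevelPlusBounded.
Variables (beta : state -> R) (B C : R).
Hypothesis beta_bounded : forall s, `|beta s| <= B.
Hypothesis excess_bounded : forall s, mean_excess b 0 s <= C.
Let H s : R := lev R s + beta s.

Lemma jumps_le_H : jumps_le P H (C + 1 + (B + B)).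
Proof.
apply: jumps_leD => //; first exact: lev_jumps.
exact: jumps_le_bounded.
Qed.

(** The cap sits above the level of [s], so it only moves targets towards [s]. Hence the jump bound
    for [H] under [P] also holds under [PN]. *)
Lemma lev_cap_lip s t :
  `|lev R (cap (level s + N) t) - lev R s| <= `|lev R t - lev R s|.
Proof.
rewrite /lev level_cap; case: (leqP (level t) (level s + N).+1) => // h.
rewrite !ger0_norm ?subr_ge0 ?ler_nat; try lia.
by rewrite lerD2r ler_nat ltnW.
Qed.

Lemma jumps_le_H_LI : jumps_le PN H (C + 1 + (B + B)).
Proof.
move=> s; have [PN0 _] := LI_stoch.
have [sl lC] := lev_jumps P_stoch jumps_finite excess_bounded s.
have [sP P1] := stoch_row P_stoch s.
have sd : summ (fun t => P s t * `|lev R t - lev R s| + (B + B) * P s t).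
  by apply: summD; [exact: summ_jumps|exact: summZ].
have le t : P s t * `|H (cap (level s + N) t) - H s| <=
    P s t * `|lev R t - lev R s| + (B + B) * P s t.
  rewrite [_ * P s t]mulrC -mulrDr ler_wpM2l// /H opprD addrACA.
  rewrite (le_trans (ler_normD _ _))// lerD ?lev_cap_lip//.
  by rewrite (le_trans (ler_normB _ _))// lerD.
have sH : summ (fun t => P s t * `|H (cap (level s + N) t) - H s|).
  by apply: le_summ sd => t; rewrite ger0_norm ?mulr_ge0.
split.
  apply: (@le_summ _ _ _ (fun t => PN s t * `|H t - H s|)).
    by move=> t; rewrite normrM (ger0_norm (PN0 s t)).
  apply: summ_ge0 => [t|]; first by rewrite mulr_ge0.
  rewrite (row_LI s (phi := fun t => `|H t - H s|))//.
  by apply: summ_esumr sH _ => t; rewrite mulr_ge0.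
rewrite (rsum_row_LI s (fun t => `|H t - H s|)).
apply: le_trans (ler_rsum sH sd le) _.
rewrite rsumD; [|exact: summ_jumps|exact: summZ].
by rewrite rsumZ// P1 mulr1 lerD2r.
Qed.

(** Capping lowers the level by exactly the excess over [N.+1]. The bounded part [beta] changes by
    at most 2 B, and only when the jump exceeds [N.+1], an event whose probability is given by
    [mean_excess_step]. *)
Lemma gen_LI_diff s :
  `|gen P H s - gen PN H s - mean_excess b N.+1 s| <=
  (B + B) * (mean_excess b N.+1 s - mean_excess b N.+2 s).
Proof.
have [sP _] := jumps_le_H s; have [sPN _] := jumps_le_H_LI s.
have se := summ_excess P_stoch jumps_finite N.+1 s.
have [su <-] := mean_excess_step P_stoch jumps_finite N.+1 s.
pose d t := P s t * (beta t - beta (cap (level s + N) t)).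
have sd : summ d.
  apply: (@summ_mean _ _ _ P_stoch _ (B + B)) => t.
  by rewrite (le_trans (ler_normB _ _))// lerD.
have -> : gen P H s - gen PN H s - mean_excess b N.+1 s = rsum d.
  have <- : gen PN H s + mean_excess b N.+1 s + rsum d = gen P H s.
    pose c t := P s t * (H (cap (level s + N) t) - H s).
    have cE : c = fun t => P s t * (H t - H s) - P s t * excess R N.+1 s t - d t.
      apply/funext => t; rewrite /c /d -!mulrBr; congr (_ * _).
      suff : lev R (cap (level s + N) t) + excess R N.+1 s t = lev R t by rewrite /H; lra.
      rewrite /lev /excess level_cap -natrD; congr (_%:R); lia.
    rewrite {1}/gen (rsum_row_LI s (fun t => H t - H s)) -/c cE.
    rewrite rsumB//; last exact: summB.
    by rewrite rsumB// -/(gen P H s) -/(mean_excess b N.+1 s); ring.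
  lra.
apply: le_trans (ler_norm_rsum sd) _; rewrite -rsumZ//.
apply: ler_rsum; [exact: summ_norm|exact: summZ|move=> t].
rewrite /d normrM ger0_norm// mulrCA ler_wpM2l//.
have [h|h] := ltnP.
  by rewrite mulr1 (le_trans (ler_normB _ _))// lerD.
by rewrite cap_id ?subrr ?normr0 ?mulr0// -addnS.
Qed.

End LevelPlusBounded.

End LITruncation.

Lemma cvgr0_norm_le (R : realType) (u v : nat -> R) :
  (forall n, `|u n| <= v n) -> v n @[n --> \oo] --> (0 : R) ->
  u n @[n --> \oo] --> (0 : R).
Proof.
move=> uv v0; apply: (@squeeze_cvgr _ _ _ _ (fun n => - v n) v) => //.
  by apply: nearW => n; rewrite -ler_norml.
by rewrite -oppr0; exact: cvgN.
Qed.

(** * Drift and asymptotics *)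

(* The total variation distance is [2 - 2 * sum (min p_n p)]. *)
Lemma scheffe (R : realType) (T : choiceType) (p_ : nat -> T -> R) (p : T -> R) :
  (forall n x, 0 <= p_ n x) -> (forall n, summ (p_ n) /\ rsum (p_ n) = 1) ->
  (forall x, 0 <= p x) -> summ p /\ rsum p = 1 ->
  (forall x, p_ n x @[n --> \oo] --> p x) ->
  rsum (fun x => `|p_ n x - p x|) @[n --> \oo] --> (0 : R).
Proof.
move=> p_0 p_1 p0 [sp p1] cp.
have sm n : summ (fun x => Num.min (p_ n x) (p x)).
  apply: le_summ sp => x; rewrite ger0_norm; first by rewrite ge_min lexx orbT.
  by rewrite le_min p_0 p0.
have mcvg : rsum (fun x => Num.min (p_ n x) (p x)) @[n --> \oo] --> (1 : R).
  rewrite -p1; apply: (@rsum_dct _ _ _ _ _ sp _ _).2 => [n x|x].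
    by rewrite ger0_norm ?le_min ?p_0 ?p0// ge_min lexx orbT.
  under eq_fun do rewrite minr_absE.
  suff : (p_ n x + p x - `|p_ n x - p x|) / 2 @[n --> \oo] -->
      (p x + p x - `|p x - p x|) / 2.
    rewrite subrr normr0 subr0.
    by have -> : (p x + p x) / 2 = p x by lra.
  apply: cvgMl; apply: cvgB; first by apply: cvgD => //; exact: cvg_cst.
  by apply: (@cvg_norm _ R^o); apply: cvgB => //; exact: cvg_cst.
have E n : rsum (fun x => `|p_ n x - p x|) =
    1 + 1 - 2%:R * rsum (fun x => Num.min (p_ n x) (p x)).
  have [sn n1] := p_1 n.
  rewrite -{1}n1 -{1}p1 -rsumD// -rsumZ// -rsumB; last 2 first.
  - exact: summD.
  - exact: summZ.
  by apply: eq_rsum => x; case: (lerP (p_ n x) (p x)) => h; lra.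
under eq_fun do rewrite E.
have -> : 0 = 1 + 1 - 2%:R * 1 :> R by lra.
by apply: cvgB; [exact: cvg_cst|exact: cvgMr].
Qed.

(** Split p_n f_n = (p_n - p) f_n + p f_n: the first part is at most M times the l1 distance, which
    tends to 0 by [scheffe]; the second converges by domination. *)
Lemma rsum_weighted_cvg (R : realType) (T : choiceType) (p_ : nat -> T -> R) (p : T -> R)
    (f_ : nat -> T -> R) (f : T -> R) (M : R) :
  (forall n x, 0 <= p_ n x) -> (forall n, summ (p_ n) /\ rsum (p_ n) = 1) ->
  (forall x, 0 <= p x) -> summ p /\ rsum p = 1 ->
  (forall x, p_ n x @[n --> \oo] --> p x) ->
  (forall n x, `|f_ n x| <= M) -> (forall x, f_ n x @[n --> \oo] --> f x) ->
  rsum (fun x => p_ n x * f_ n x) @[n --> \oo] --> rsum (fun x => p x * f x).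
Proof.
move=> p_0 p_1 p0 p1 cp fM cf.
have tv := scheffe p_0 p_1 p0 p1 cp; have [sp _] := p1.
have sd n : summ (fun x => `|p_ n x - p x|).
  by apply: summ_norm; apply: summB => //; case: (p_1 n).
have sdf n : summ (fun x => (p_ n x - p x) * f_ n x).
  apply: le_summ (summZ M (sd n)) => x.
  by rewrite normrM mulrC ler_wpM2r.
have spf n : summ (fun x => p x * f_ n x).
  by apply: le_summ (summZ M sp) => x; rewrite normrM (ger0_norm (p0 x)) mulrC ler_wpM2r.
have E n : rsum (fun x => p_ n x * f_ n x) =
    rsum (fun x => (p_ n x - p x) * f_ n x) + rsum (fun x => p x * f_ n x).
  by rewrite -rsumD//; apply: eq_rsum => x; ring.
under eq_fun do rewrite E.
rewrite -[rsum (fun x => p x * f x)]add0r; apply: cvgD; last first.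
  apply: (@rsum_dct _ _ _ _ _ (summZ M sp) _ _).2 => [n x|x].
    by rewrite normrM (ger0_norm (p0 x)) mulrC ler_wpM2r.
  exact: cvgMr.
apply: (@cvgr0_norm_le _ _ (fun n => M * rsum (fun x => `|p_ n x - p x|))).
  move=> n; rewrite -rsumZ//; apply: le_trans (ler_norm_rsum (sdf n)) _.
  apply: ler_rsum; [exact: summ_norm|exact: summZ|move=> x].
  by rewrite normrM mulrC ler_wpM2r.
by rewrite -(mulr0 M); exact: cvgMr.
Qed.

(** * Finiteness of the means, and the function with constant drift off one state *)

Section Drift.
Variables (R : realType) (M0 M1 : nat) (b : MG1_blocks R M0 M1).
Local Notation state := (state M0 M1).
Local Notation P := (MG1_matrix b).
Hypothesis P_stoch : stochastic P.

Lemma meanBE (i : 'I_M0) : meanB b i =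
  esumr (fun m => m.+1%:R * jump_mass b (@mkstate M0 M1 0 i) m).
Proof.
pose f k : R := k%:R * (blockB b k *m ones R (phases M0 M1 k)) i ord0.
have fS m : f m.+1 = m.+1%:R * jump_mass b (@mkstate M0 M1 0 i) m.
  rewrite /f mxE; congr (_ * _); apply: eq_bigr => j _.
  by rewrite [X in _ * X]mxE mulr1.
rewrite /meanB (@nneseries_esumr _ f).
  by apply: eq_esumr => m; rewrite addn1 fS.
by move=> [//|m] _; rewrite fS mulr_ge0// jump_mass_ge0.
Qed.

Lemma meanA_plusE k (i : 'I_M1) : meanA_plus b i =
  esumr (fun m => m.+1%:R * jump_mass b (@mkstate M0 M1 k.+1 i) m).
Proof.
pose f k : R := k%:R * (blockA b k%:Z *m ones R M1) i ord0.
have fS m : f m.+1 = m.+1%:R * jump_mass b (@mkstate M0 M1 k.+1 i) m.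
  rewrite /f mxE; congr (_ * _); apply: eq_bigr => j _.
  by rewrite [X in _ * X]mxE mulr1.
rewrite /meanA_plus (@nneseries_esumr _ f).
  by apply: eq_esumr => m; rewrite addn1 fS.
by move=> [//|m] _; rewrite fS mulr_ge0// jump_mass_ge0.
Qed.

(** Once the only negative term, k = -1, is split off, the series is nonnegative, so its limit
    exists even if infinite. *)
Lemma meanAE (i : 'I_M1) : meanA b i = ((- down_mass b i)%:E + meanA_plus b i)%E.
Proof.
pose x k := (blockA b (k%:Z - 1) *m ones R M1) i ord0.
have xE k : x k = \sum_j blockA b (k%:Z - 1) i j.
  by rewrite /x mxE; apply: eq_bigr => j _; rewrite [X in _ * X]mxE mulr1.
have x0 k : 0 <= x k.
  by rewrite xE sumr_ge0// => j _; exact: blockA_ge0.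
pose f k := k%:R * x k.+1.
have f0 k : 0 <= f k by rewrite mulr_ge0.
have pE : meanA_plus b i = (\sum_(0 <= k <oo) (f k)%:E)%E.
  rewrite nneseries_esumr// (@meanA_plusE 0).
  rewrite (@esumr_nat_drop _ (fun k => f (k + 0)%N) 1).
  - apply: eq_esumr => m; rewrite addn0 addn1 /f xE /jump_mass; congr (_ * _).
  - by move=> k; exact: f0.
  - by move=> [|//] _; rewrite /f mul0r.
apply: cvg_lim => //; rewrite -cvg_shiftS.
have E n : (\sum_(0 <= k < n.+1) ((k%:R - 1) * x k)%:E)%E =
    ((- down_mass b i)%:E + \sum_(0 <= k < n) (f k)%:E)%E.
  rewrite big_nat_recl//; congr (_ + _)%E.
    by rewrite xE sub0r mulN1r.
  by apply: eq_bigr => k _; rewrite /f -natr1 addrK.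
under eq_fun do rewrite E.
rewrite pE; apply: cvgeD.
- by rewrite fin_num_adde_defr.
- exact: cvg_cst.
- by apply: is_cvg_nneseries => k _ _; rewrite lee_fin.
Qed.

Hypothesis A_stoch : stochastic (sumA b).
Hypothesis A_irr : irreducible (sumA b).
Variable varpi : 'rV[R]_M1.
Hypothesis varpi_stat : stationary_distribution (sumA b) (varpi ord0).
Hypothesis meanB_finite : forall i, (meanB b i < +oo)%E.
Hypothesis drift_lt0 : (drift b varpi < 0)%E.

Lemma meanA_plus_ge0 i : (0 <= meanA_plus b i)%E.
Proof.
rewrite (meanA_plusE 0); apply: esumr_ge0 => m.
by rewrite mulr_ge0// jump_mass_ge0.
Qed.

(** A consequence of negative drift: [varpi] charges every phase, so one infinite mean would make
    the drift +oo, the other terms being bounded below through [down_mass]. *)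
Lemma meanA_plus_finite i : (meanA_plus b i < +oo)%E.
Proof.
rewrite ltey; apply/negP => /eqP mi.
have vi : 0 < varpi ord0 i := stat_gt0 A_stoch varpi_stat A_irr i.
move: drift_lt0; rewrite /drift (bigD1 i)//= meanAE mi addey//.
rewrite gt0_muley ?lte_fin// addye//.
rewrite -ltNye; apply: (@lt_le_trans _ _
  (\sum_(l < M1 | l != i) (varpi ord0 l * - down_mass b l)%:E)%E).
  by rewrite sumEFin ltNyr.
apply: lee_sum => l _; rewrite EFinM; apply: lee_wpmul2l.
  by rewrite lee_fin (stat_ge0 varpi_stat).
by rewrite meanAE leeDl// meanA_plus_ge0.
Qed.

Lemma jumps_finite s : (esumr (fun m => m.+1%:R * jump_mass b s m)%R < +oo)%E.
Proof.
case: s => [[|k] i]; first by rewrite -meanBE.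
by rewrite -(meanA_plusE k) meanA_plus_finite.
Qed.

Lemma mean_excess0_kind s : (mean_excess b 0 s) =
  by_kind (fun i => fine (meanB b i)) (fun i => fine (meanA_plus b i)) s.
Proof.
have := mean_excess0 P_stoch jumps_finite s.
case: s => [[|k] i] /=; first by rewrite meanBE => <-.
by rewrite (meanA_plusE k) => <-.
Qed.

Definition phase_drift i := fine (meanA_plus b i) - down_mass b i.

Lemma driftE : fine (drift b varpi) = \sum_i varpi ord0 i * phase_drift i.
Proof.
rewrite /drift (eq_bigr (fun i => (varpi ord0 i * phase_drift i)%:E)).
  by rewrite sumEFin.
move=> i _; rewrite EFinM; congr (_ * _)%E.
rewrite meanAE /phase_drift EFinB addeC fineK// ge0_fin_numE ?meanA_plus_ge0//.
exact: meanA_plus_finite.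
Qed.

(** The phase set is finite, so the whole of it serves as support, and [0 < M1] supplies a state to
    kill at. The right-hand side has mean zero under [varpi] and [varpi] is positive, which forces
    the coefficient [c] to vanish. *)
Lemma phase_poisson : (0 < M1)%N -> exists a : 'I_M1 -> R,
  forall i, gen (sumA b) a i = fine (drift b varpi) - phase_drift i.
Proof.
move=> hM1; set sigma := fine _.
have [|a [B [c [aB aE]]]] := @poisson_solution _ _ _ A_stoch A_irr (enum 'I_M1)
  (fun i => phase_drift i - sigma) (Ordinal hM1).
  by move=> i; rewrite mem_enum.
exists a => i; rewrite aE.
suff -> : c = 0 by rewrite mul0r sub0r opprB.
have := stat_gen A_stoch varpi_stat (jumps_le_bounded A_stoch aB).
rewrite (rsum_finType _).2; under eq_bigr do rewrite aE mulrBr mulrBr.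
rewrite sumrB sumrB -driftE -mulr_suml.
have [_] := stat_sum varpi_stat; rewrite (rsum_finType _).2 => ->.
rewrite mul1r subrr subr0 (bigD1 (Ordinal hM1))//= ?eqxx mulr1 big1 ?addr0.
  move=> /eqP; rewrite mulf_eq0 gt_eqF/=; first by move=> /eqP.
  exact: stat_gt0 varpi_stat A_irr _.
by move=> l /negPf ->; rewrite !mulr0.
Qed.

Hypothesis P_irr : irreducible P.
Variable pi : state -> R.
Hypothesis pi_stat : stationary_distribution P pi.
Hypothesis hM1 : (0 < M1)%N.

Let sigma := fine (drift b varpi).

Lemma mean_excess0_bounded : exists C, forall s, mean_excess b 0 s <= C.
Proof.
eexists => s; rewrite mean_excess0_kind; apply: le_trans (ler_norm _) _.
exact: by_kind_bounded.
Qed.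

(* Off levels 0 and 1 the function [level + a], with [a] from [phase_poisson],
   has exactly the drift [sigma]; the remaining defect has finite support and is
   absorbed by a bounded function. *)
Lemma lyapunov (j : state) : exists (beta : state -> R) (B : R),
  (forall s, `|beta s| <= B) /\
  forall s, gen P (fun t => lev R t + beta t) s = sigma - sigma / pi j * (s == j)%:R.
Proof.
have [C eC] := mean_excess0_bounded.
have levC := lev_jumps P_stoch jumps_finite eC.
have [a aE] := phase_poisson hM1.
have aB := @by_kind_bounded R M0 M1 (fun=> 0) a.
have aJ := jumps_le_bounded P_stoch aB.
pose V (t : state) := lev R t + by_kind (fun=> 0) a t.
pose K : seq state := [seq @mkstate M0 M1 0 i | i <- enum 'I_M0] ++
                      [seq @mkstate M0 M1 1 i | i <- enum 'I_M1].
have [|h [B [c [hB hE]]]] := @poisson_solution _ _ _ P_stoch P_irr K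
  (fun s => gen P V s - sigma) j.
  case=> [[|[|k]] i] iK.
  - by move: iK; rewrite mem_cat map_f ?mem_enum.
  - by move: iK; rewrite mem_cat orbC map_f ?mem_enum.
  rewrite (genD _ levC aJ) (gen_lev P_stoch jumps_finite).
  by rewrite (gen_phase P_stoch) aE mean_excess0_kind /= /phase_drift -/sigma; ring.
have hJ := jumps_le_bounded P_stoch hB.
have HJ := jumps_leD P_stoch (jumps_leD P_stoch levC aJ) hJ.
have HE s : gen P (fun t => V t + h t) s = sigma + c * (s == j)%:R.
  by rewrite (genD _ (jumps_leD P_stoch levC aJ) hJ) hE; ring.
have pj := stat_gt0 P_stoch pi_stat P_irr j.
(* Integrating [HE] against [pi] makes the left-hand side vanish by [stat_gen], leaving 0 = sigma +
   c pi(j). *)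
have cE : c = - (sigma / pi j).
  have := stat_gen P_stoch pi_stat HJ; rewrite -/V.
  under eq_rsum do rewrite HE mulrDr.
  have [sp p1] := stat_sum pi_stat.
  rewrite rsumD; last 2 first.
  - by have := summZ sigma sp; apply: eq_summ => s; exact: mulrC.
  - have := summ_single j (pi j * c); apply: eq_summ => s.
    by case: eqP => [->|_]; rewrite ?mul1r ?mulr1 ?mul0r ?mulr0.
  under [X in rsum X + _]eq_fun do rewrite mulrC.
  rewrite [X in _ + X](eq_rsum (g := fun s => (s == j)%:R * (c * pi s))); last first.
    by move=> s; rewrite mulrA mulrC [pi s * c]mulrC.
  rewrite rsumZ// p1 mulr1 (rsum_single j (fun s => c * pi s)) => H.
  have -> : sigma = - (c * pi j) by lra.
  by rewrite mulNr opprK mulfK// gt_eqF.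
exists (fun s => by_kind (fun=> 0) a s + h s); eexists; split.
  by move=> s; apply: le_trans (ler_normD _ _) _; apply: lerD; [exact: aB|exact: hB].
move=> s; rewrite (_ : (fun t => _) = fun t => V t + h t).
  by rewrite HE cE mulNr.
by apply/funext => t; rewrite /V addrA.
Qed.

End Drift.

Lemma cvgr_bounded (R : realType) (u : nat -> R) (l : R) :
  u n @[n --> \oo] --> l -> exists K, forall n, `|u n| <= K.
Proof.
move=> ul; have [|M [_ HM]] := @cvg_seq_bounded R R^o u.
  by apply/cvg_ex; exists l.
exists (M + 1) => n; apply: HM => //; by rewrite ltrDl.
Qed.

(** * Tail of D_I, convergence of the truncated chains and its exact rate *)

Section Asymptotics.
Variables (R : realType) (M0 M1 : nat) (b : MG1_blocks R M0 M1).
Local Notation state := (state M0 M1).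
Local Notation P := (MG1_matrix b).
Hypothesis hM1 : (0 < M1)%N.
Hypothesis P_stoch : stochastic P.
Hypothesis P_irr : irreducible P.
Hypothesis A_stoch : stochastic (sumA b).
Hypothesis A_irr : irreducible (sumA b).
Variable varpi : 'rV[R]_M1.
Hypothesis varpi_stat : stationary_distribution (sumA b) (varpi ord0).
Hypothesis meanB_finite : forall i, (meanB b i < +oo)%E.
Hypothesis drift_lt0 : (drift b varpi < 0)%E.
Variable pi : state -> R.
Hypothesis pi_stat : stationary_distribution P pi.

Let sigma := fine (drift b varpi).
Let jfin := jumps_finite P_stoch A_stoch A_irr varpi_stat meanB_finite drift_lt0.
Let plus_fin := meanA_plus_finite P_stoch A_stoch A_irr varpi_stat drift_lt0.

Definition total_excess N : R := rsum (fun s => pi s * mean_excess b N s).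

Lemma mean_excess_bounded : exists C, forall N s, `|mean_excess b N s| <= C.
Proof.
have [C HC] := mean_excess0_bounded P_stoch A_stoch A_irr varpi_stat
  meanB_finite drift_lt0.
exists C => N s; rewrite ger0_norm ?mean_excess_ge0//.
by apply: le_trans (HC s); apply: mean_excess_homo.
Qed.

Lemma summ_total_excess N : summ (fun s => pi s * mean_excess b N s).
Proof.
by have [C HC] := mean_excess_bounded; exact: (summ_stat pi_stat (HC N)).
Qed.

Lemma increment_tail k :
  1 - increment_cdf b pi k = total_excess k - total_excess k.+1.
Proof.
have [P0 _] := P_stoch.
have inner s : (\esum_(t in [set t : state | (level t - level s <= k)%N]) (P s t)%:E)%E =
    (1 - (mean_excess b k s - mean_excess b k.+1 s))%:E.
  have [sP P1] := stoch_row P_stoch s.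
  have [su <-] := mean_excess_step P_stoch jfin k s.
  have d0 t : 0 <= P s t - P s t * (level s + k < level t)%:R.
    by case: (_ < _)%N; rewrite ?mulr1 ?mulr0 ?subrr ?subr0.
  rewrite (_ : 1 - _ = rsum (fun t => P s t - P s t * (level s + k < level t)%:R));
    last by rewrite rsumB// P1.
  rewrite rsumK//; last exact: summB.
  rewrite esum_mkcond; apply: eq_esum => t _.
  have -> : (t \in [set t : state | (level t - level s <= k)%N]) =
      ~~ (level s + k < level t)%N.
    by apply/idP/idP; rewrite in_setE /=; lia.
  by case: (_ < _)%N; rewrite ?mulr1 ?mulr0 ?subrr ?subr0.
have [sp p1] := stat_sum pi_stat.
have sk := summ_total_excess k; have sk1 := summ_total_excess k.+1.
rewrite /increment_cdf.
under eq_esum do rewrite inner -EFinM.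
rewrite -[X in fine X]/(esumr _) -rsum_esumr.
- under eq_rsum do rewrite 2!mulrBr mulr1.
  rewrite rsumB//; last exact: (summB sk sk1).
  by rewrite rsumB// p1 /total_excess; ring.
- move=> s; rewrite mulr_ge0 ?(stat_ge0 pi_stat)// -lee_fin -inner.
  by apply: esum_ge0 => t _; rewrite lee_fin.
- apply: summ_esumr.
    have := summB sp (summB sk sk1); apply: eq_summ => s.
    by ring.
  move=> s; rewrite mulr_ge0 ?(stat_ge0 pi_stat)// -lee_fin -inner.
  by apply: esum_ge0 => t _; rewrite lee_fin.
Qed.

(** Sums of 1 - D telescope by [increment_tail]: the full series is [total_excess 0], and stopping
    after l = N leaves [total_excess N.+1]. *)
Lemma integrated_tailE N : total_excess n @[n --> \oo] --> (0 : R) ->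
  0 < total_excess 0 ->
  1 - integrated_tail (increment_cdf b pi) N = total_excess N.+1 / total_excess 0.
Proof.
move=> t0 tp.
have part n : \sum_(0 <= l < n) (1 - increment_cdf b pi l) =
    total_excess 0 - total_excess n.
  elim: n => [|n IHn]; first by rewrite big_nil subrr.
  by rewrite big_nat_recr//= IHn increment_tail; ring.
rewrite /integrated_tail part.
have -> : \sum_(0 <= l <oo) (1 - increment_cdf b pi l) = total_excess 0.
  apply: cvg_lim => //; under eq_fun do rewrite part.
  have : total_excess 0 - total_excess n @[n --> \oo] --> total_excess 0 - 0.
    by apply: cvgB => //; exact: cvg_cst.
  by rewrite subr0.
by field; rewrite gt_eqF.
Qed.

(** The mean jump depends only on the kind of state, so its sum against [pi] collapses to level 0
    plus the phase marginal [level_tail0] of the positive levels. *)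
Lemma mean_incrementE : fine (mean_increment b pi) = total_excess 0.
Proof.
pose mB i := fine (meanB b i); pose mA i := fine (meanA_plus b i).
have mBE i : meanB b i = (mB i)%:E.
  rewrite /mB fineK// ge0_fin_numE// meanBE//; apply: esumr_ge0 => m.
  by rewrite mulr_ge0// jump_mass_ge0.
have mAE i : meanA_plus b i = (mA i)%:E.
  by rewrite /mA fineK// ge0_fin_numE ?meanA_plus_ge0.
have mB0 i : 0 <= mB i.
  by rewrite -lee_fin -mBE meanBE//; apply: esumr_ge0 => m; rewrite mulr_ge0// jump_mass_ge0.
have mA0 i : 0 <= mA i by rewrite -lee_fin -mAE meanA_plus_ge0.
have p0 := stat_ge0 pi_stat; have [sp p1] := stat_sum pi_stat.
have su (j : 'I_M1) : summ (fun l => pi (@mkstate M0 M1 l.+1 j)).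
  apply: summ_ge0 => [l|]; first exact: p0.
  apply: le_lt_trans (summ_esumr sp p0); rewrite [leRHS]esumr_level//.
  rewrite [leRHS](esumr_nat_split 1); last by move=> k; rewrite sumr_ge0.
  apply: (@le_trans _ _ (esumr (fun k => \sum_(i < M1) pi (@mkstate M0 M1 k.+1 i)))).
    by apply: le_esumr => k; rewrite (bigD1 j)//= lerDl sumr_ge0.
  rewrite (eq_esumr (g := fun k => \sum_(i < phases M0 M1 (k + 1)) pi (mkstate i))).
    by rewrite leeDr// lee_fin sumr_ge0// => k _; rewrite sumr_ge0.
  by move=> k; rewrite addn1.
have tl (j : 'I_M1) : level_tail0 pi ord0 j = rsum (fun l => pi (@mkstate M0 M1 l.+1 j)).
  rewrite mxE (@series_rsum _ (fun l => (level_vec pi l.+1 : 'rV[R]_M1) ord0 j)).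
  - by apply: eq_rsum => l; rewrite mxE addn0.
  - by move=> l _; rewrite mxE.
  - by apply: eq_summ (su j) => l; rewrite mxE addn0.
have e0 s : 0 <= pi s * mean_excess b 0 s by rewrite mulr_ge0 ?mean_excess_ge0.
have T : (total_excess 0)%:E =
   (\sum_i level_vec pi 0 ord0 i * mB i + \sum_j level_tail0 pi ord0 j * mA j)%:E.
  rewrite /total_excess rsumK//; last exact: summ_total_excess.
  rewrite esumr_level// (esumr_nat_split 1); last by move=> k; rewrite sumr_ge0.
  rewrite big_ord_recl big_ord0 addr0 [RHS]EFinD; congr (_%:E + _)%E.
    apply: eq_bigr => i _; rewrite mxE; congr (_ * _).
    by rewrite (mean_excess0_kind P_stoch A_stoch A_irr varpi_stat meanB_finite drift_lt0).
  transitivity (esumr (fun k => \sum_j mA j * pi (@mkstate M0 M1 k.+1 j))).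
    apply: eq_esumr => k; rewrite addn1; apply: eq_bigr => j _; rewrite mulrC.
    by rewrite (mean_excess0_kind P_stoch A_stoch A_irr varpi_stat meanB_finite drift_lt0).
  rewrite esumr_sum; last by move=> *; rewrite mulr_ge0.
  rewrite -sumEFin; apply: eq_bigr => j _.
  by rewrite esumrZ// -rsumK// -tl EFinM muleC.
rewrite /mean_increment -[RHS]/(fine (total_excess 0)%:E) T EFinD -!sumEFin.
congr (fine (_ + _)%E); apply: eq_bigr => i _; first by rewrite mBE EFinM.
by rewrite mAE EFinM.
Qed.

Variable F : nat -> R.
Hypothesis F_dist : distribution_function F.
Hypothesis F_long : long_tailed F.
Variables (cA : 'cV[R]_M1) (cB : 'cV[R]_M0).
Hypothesis cA_ge0 : forall i, 0 <= cA i ord0.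
Hypothesis cB_ge0 : forall i, 0 <= cB i ord0.
Hypothesis cAB_neq0 : cA != 0 \/ cB != 0.
Hypothesis tailA_lim : forall i,
  (tail2A b N *m ones R M1) i ord0 / (1 - F N) @[N --> \oo] --> cA i ord0.
Hypothesis tailB_lim : forall i,
  (tail2B b N *m ones R M1) i ord0 / (1 - F N) @[N --> \oo] --> cB i ord0.

Let Fb N := 1 - F N.
Let Fb_gt0 N : 0 < Fb N. Proof. by case: F_long => /(_ N). Qed.

Lemma Fb_cvg0 : Fb n @[n --> \oo] --> (0 : R).
Proof.
have [_ _ F1] := F_dist.
have := cvgB (cvg_cst (1 : R)) F1; rewrite subrr; exact.
Qed.

Lemma Fb_ratio : Fb n.+1 / Fb n @[n --> \oo] --> (1 : R).
Proof.
by case: F_long => _ /(_ 1%N); under eq_fun do rewrite addn1.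
Qed.

(** Long-tailedness in the form used below: r_{N+1} and r_{N+2} have the same limit relative to 1 -
    F(N), so their difference is negligible. *)
Lemma ratio_shift (u : nat -> R) (l : R) :
  u n / Fb n @[n --> \oo] --> l -> u n.+1 / Fb n @[n --> \oo] --> l.
Proof.
rewrite -(cvg_shiftS (fun n => u n / Fb n)) => ul.
have : (u n.+1 / Fb n.+1) * (Fb n.+1 / Fb n) @[n --> \oo] --> l * 1.
  exact: cvgM ul Fb_ratio.
rewrite mulr1; under eq_fun => n do rewrite mulrA divfK ?gt_eqF//.
by [].
Qed.

Let weight (s : state) : R := by_kind (fun i => cB i ord0) (fun i => cA i ord0) s.

Lemma excess_ratio s : mean_excess b n.+1 s / Fb n @[n --> \oo] --> weight s.
Proof.
under eq_fun do rewrite (mean_excessS P_stoch jfin).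
by case: s => [[|k] i]; [exact: tailB_lim|exact: tailA_lim].
Qed.

(** Uniform in the state because only finitely many sequences occur, each convergent; [q] adds their
    absolute values. *)
Lemma excess_ratio_bounded :
  exists K, forall n s, `|mean_excess b n.+1 s / Fb n| <= K.
Proof.
pose q n := \sum_i `|(tail2B b n *m ones R M1) i ord0 / Fb n| +
            \sum_i `|(tail2A b n *m ones R M1) i ord0 / Fb n|.
have [|K HK] := @cvgr_bounded _ q (\sum_i `|cB i ord0| + \sum_i `|cA i ord0|).
  by apply: cvgD; apply: cvgr_sum => i; apply: (@cvg_norm _ R^o).
exists K => n s; apply: le_trans (HK n); apply: le_trans (ler_norm _).
rewrite (mean_excessS P_stoch jfin).
have := by_kind_bounded (fun i => (tail2B b n *m ones R M1) i ord0 / Fb n)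
  (fun i => (tail2A b n *m ones R M1) i ord0 / Fb n) s.
by case: s => [[|k] i].
Qed.

Let kappa := rsum (fun s => pi s * weight s).

(** A nonzero entry of [cA] or [cB] is the weight of a state at level 1 or 0, which [pi] charges.
    The final step divides by [kappa]. *)
Lemma kappa_gt0 : 0 < kappa.
Proof.
have pi0 := stat_gt0 P_stoch pi_stat P_irr.
have w0 s : 0 <= weight s.
  by case: s => [[|k] i]; [exact: cB_ge0|exact: cA_ge0].
have [s ws] : exists s, 0 < weight s.
  case: cAB_neq0 => c0.
    have /existsP[i ci] : [exists i, cA i ord0 != 0].
      apply: contraNT c0; rewrite negb_exists => /forallP H.
      by apply/eqP/matrixP => i k; rewrite ord1 mxE; apply/eqP; have := H i; rewrite negbK.
    exists (@mkstate M0 M1 1 i); by rewrite /weight /= lt_neqAle eq_sym ci cA_ge0.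
  have /existsP[i ci] : [exists i, cB i ord0 != 0].
    apply: contraNT c0; rewrite negb_exists => /forallP H.
    by apply/eqP/matrixP => i k; rewrite ord1 mxE; apply/eqP; have := H i; rewrite negbK.
  exists (@mkstate M0 M1 0 i); by rewrite /weight /= lt_neqAle eq_sym ci cB_ge0.
apply: lt_le_trans (_ : pi s * weight s <= _); first by rewrite mulr_gt0.
apply: (@summ_term _ _ (fun s => pi s * weight s)) => [t|].
  by rewrite mulr_ge0// ltW.
by apply: (summ_stat pi_stat) => t; exact: by_kind_bounded.
Qed.

Lemma total_excess_ratio : total_excess n.+1 / Fb n @[n --> \oo] --> kappa.
Proof.
have [K HK] := excess_ratio_bounded; have [sp _] := stat_sum pi_stat.
have E n : total_excess n.+1 / Fb n =
    rsum (fun s => pi s * (mean_excess b n.+1 s / Fb n)).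
  rewrite mulrC -rsumZ; last exact: summ_total_excess.
  by apply: eq_rsum => s; ring.
under eq_fun do rewrite E.
apply: (@rsum_dct _ _ _ _ _ (summZ K sp) _ _).2 => [n s|s].
  by rewrite normrM (ger0_norm (stat_ge0 pi_stat s)) mulrC ler_wpM2r ?(stat_ge0 pi_stat).
apply: cvgMr; exact: excess_ratio.
Qed.

Lemma total_excess_cvg0 : total_excess n @[n --> \oo] --> (0 : R).
Proof.
rewrite -(cvg_shiftS total_excess).
have : total_excess n.+1 / Fb n * Fb n @[n --> \oo] --> kappa * 0.
  exact: cvgM total_excess_ratio Fb_cvg0.
rewrite mulr0.
by under eq_fun => n do rewrite divfK ?gt_eqF//.
Qed.

(** By monotonicity a zero would persist at all larger indices and force [kappa] to be 0. This keeps
    1 - D_I(N) positive. *)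
Lemma total_excess_gt0 N : 0 < total_excess N.
Proof.
have homo n m : (n <= m)%N -> total_excess m <= total_excess n.
  move=> nm; apply: ler_rsum; [exact: summ_total_excess..|move=> s].
  by rewrite ler_wpM2l ?(stat_ge0 pi_stat)// (mean_excess_homo P_stoch jfin).
rewrite ltNge; apply/negP => tN.
have z n : total_excess (n + N).+1 / Fb (n + N) = 0.
  apply/eqP; rewrite mulf_eq0; apply/orP; left; rewrite eq_le.
  rewrite (le_trans _ tN) ?homo//=; last lia.
  by apply: rsum_ge0 => s; rewrite mulr_ge0 ?mean_excess_ge0 ?(stat_ge0 pi_stat).
have := total_excess_ratio; rewrite -(cvg_shiftn N (fun n => total_excess n.+1 / Fb n)).
under eq_fun do rewrite z.
move=> /cvg_lim; rewrite lim_cst// => /(_ (@Rhausdorff R)) k0.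
by have := kappa_gt0; rewrite -k0 ltxx.
Qed.

Variable piN : nat -> state -> R.
Hypothesis piN_stat : forall N, (0 < N)%N ->
  stationary_distribution (MG1_matrix (LI_truncation N b)) (piN N).

(** Here [z N] is (P - PN) H. Against [piN N.+1] the part with PN integrates to zero and the part
    with P gives sigma - sigma piN(j) / pi(j). The statement hides H, which depends on [j], and
    keeps only the closeness of [z] to the mean excess. *)
Lemma perturbation (j : state) : exists (z : nat -> state -> R) (B : R),
  [/\ 0 <= B, forall N s, `|z N s - mean_excess b N.+1 s| <=
        B * (mean_excess b N.+1 s - mean_excess b N.+2 s) &
    forall N, - sigma * (piN N.+1 j - pi j) =
              pi j * rsum (fun s => piN N.+1 s * z N s)].
Proof.
have [beta [B [betaB HE]]] := lyapunov P_stoch A_stoch A_irr varpi_stat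
  meanB_finite drift_lt0 P_irr pi_stat hM1 j.
have [C eC] := mean_excess0_bounded P_stoch A_stoch A_irr varpi_stat
  meanB_finite drift_lt0.
pose PN N := MG1_matrix (LI_truncation N.+1 b).
pose H t := lev R t + beta t.
exists (fun N s => gen P H s - gen (PN N) H s), (B + B); split.
- by have := betaB j; have := normr_ge0 (beta j); lra.
- by move=> N s; exact: gen_LI_diff eC s.
move=> N; have qstat : stationary_distribution (PN N) (piN N.+1) by exact: piN_stat.
have qst := LI_stoch P_stoch jfin N.
have pj := stat_gt0 P_stoch pi_stat P_irr j.
have HJ := jumps_le_H P_stoch jfin betaB eC.
have HJN := jumps_le_H_LI P_stoch jfin N betaB eC.
have s1 : summ (fun s => piN N.+1 s * gen P H s).
  by apply: (summ_stat qstat) => s; exact: (gen_norm_le P_stoch s HJ).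
have s2 : summ (fun s => piN N.+1 s * gen (PN N) H s).
  by apply: (summ_stat qstat) => s; exact: (gen_norm_le qst s HJN).
have -> : rsum (fun s => piN N.+1 s * (gen P H s - gen (PN N) H s)) =
    sigma - sigma / pi j * piN N.+1 j.
  under eq_rsum do rewrite mulrBr.
  rewrite rsumB// (stat_gen qst qstat HJN) subr0.
  have [sq q1] := stat_sum qstat.
  rewrite (eq_rsum (g := fun s => sigma * piN N.+1 s -
      (s == j)%:R * (sigma / pi j * piN N.+1 s))); last first.
    by move=> s; rewrite HE -/sigma; ring.
  rewrite rsumB ?rsumZ// ?q1 ?mulr1 ?rsum_single//; first exact: summZ.
  have := summ_single j (sigma / pi j * piN N.+1 j); apply: eq_summ => s.
  by case: eqP => [->|_]; rewrite ?mul0r.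
by field; rewrite gt_eqF.
Qed.

(** Negativity does not pass through [fine] by itself, since [fine] sends -oo to 0; the drift is
    first shown to be a finite sum of reals. *)
Let sigma_lt0 : sigma < 0.
Proof.
rewrite -lte_fin /sigma fineK//.
move: drift_lt0; rewrite /drift.
have E i : ((varpi ord0 i)%:E * meanA b i = (varpi ord0 i * phase_drift b i)%:E)%E.
  rewrite EFinM; congr (_ * _)%E.
  rewrite meanAE// /phase_drift EFinB addeC fineK// ge0_fin_numE ?meanA_plus_ge0//.
under eq_bigr do rewrite E.
by rewrite sumEFin.
Qed.

(** The crude use of [perturbation]: |z| <= (1 + B) r_{N+1} <= (1 + B) K (1 - F(N)) at every state,
    and [piN] has mass one. *)
Lemma piN_cvg (j : state) : piN n.+1 j @[n --> \oo] --> pi j.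
Proof.
have [z [B [B0 zB zE]]] := perturbation j.
have [K HK] := excess_ratio_bounded.
have pj := stat_gt0 P_stoch pi_stat P_irr j.
have K0 : 0 <= K by apply: le_trans (HK 0%N j).
have zK n s : `|z n s| <= (1 + B) * K * Fb n.
  have m0 := mean_excess_ge0 P_stoch n.+2 s.
  have m1 := mean_excess_ge0 P_stoch n.+1 s.
  have : `|z n s| <= (1 + B) * mean_excess b n.+1 s.
    have := zB n s; rewrite ler_norml => /andP[h1 h2].
    have Bm : 0 <= B * mean_excess b n.+2 s by rewrite mulr_ge0.
    have Bm1 : 0 <= B * mean_excess b n.+1 s by rewrite mulr_ge0.
    rewrite ler_norml; apply/andP; split; lra.
  move/le_trans; apply; rewrite -mulrA ler_wpM2l ?addr_ge0//.
  by rewrite -ler_pdivrMr//; apply: le_trans (HK n s); exact: ler_norm.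
apply/subr_cvg0/(@cvgr0_norm_le _ _ (fun n => pi j / - sigma * ((1 + B) * K) * Fb n)); last first.
  by rewrite -(mulr0 (pi j / - sigma * ((1 + B) * K))); apply: cvgMr; exact: Fb_cvg0.
move=> n; have qstat := piN_stat (ltn0Sn n).
have := zE n => E.
have -> : piN n.+1 j - pi j = pi j / - sigma * rsum (fun s => piN n.+1 s * z n s).
  apply: (@mulfI _ (- sigma)); first by rewrite oppr_eq0 lt_eqF.
  by rewrite E; field; rewrite lt_eqF.
have a0 : 0 <= pi j / - sigma by rewrite divr_ge0 ?oppr_ge0 ?ltW.
rewrite normrM (ger0_norm a0) -[leRHS]mulrA ler_wpM2l//.
apply: le_trans (ler_norm_rsum (summ_stat qstat (zK n))) _.
have [sq q1] := stat_sum qstat.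
have -> : (1 + B) * K * Fb n = rsum (fun s => (1 + B) * K * Fb n * piN n.+1 s).
  by rewrite rsumZ// q1 mulr1.
apply: ler_rsum.
- exact/summ_norm/(summ_stat qstat (zK n)).
- exact: summZ.
- move=> s; rewrite normrM (ger0_norm (stat_ge0 qstat s)) [leRHS]mulrC.
  exact: (ler_wpM2l (stat_ge0 qstat s) (zK n s)).
Qed.

Let C := fine (mean_increment b pi) / - sigma.
Let DI := integrated_tail (increment_cdf b pi).

Lemma C_gt0 : 0 < C.
Proof. by rewrite /C mean_incrementE divr_gt0 ?oppr_gt0// total_excess_gt0. Qed.

Lemma DI_tail N : 1 - DI N = total_excess N.+1 / total_excess 0.
Proof.
by apply: integrated_tailE; [exact: total_excess_cvg0|exact: total_excess_gt0].
Qed.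

(** The sharp use of [perturbation]: relative to 1 - F(N), both the integral of [z] against [piN]
    and the total excess tend to [kappa], which cancels in the quotient. *)
Lemma piN_asymptotics (j : state) :
  (piN n j - pi j) / (1 - DI n) @[n --> \oo] --> C * pi j.
Proof.
(* At index 0 nothing is known about [piN]; from here on the truncation parameter is [n.+1]. *)
rewrite -(cvg_shiftS (fun n => (piN n j - pi j) / (1 - DI n))).
have [z [B [B0 zB zE]]] := perturbation j.
have [K HK] := excess_ratio_bounded.
have K0 : 0 <= K by apply: le_trans (HK 0%N j).
have t0 := total_excess_gt0 0.
have r2 s : mean_excess b n.+2 s / Fb n @[n --> \oo] --> weight s.
  exact: (@ratio_shift (fun n => mean_excess b n.+1 s) (weight s) (@excess_ratio s)).
have zb n s : `|z n s - mean_excess b n.+1 s| / Fb n <=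
    B * (mean_excess b n.+1 s / Fb n - mean_excess b n.+2 s / Fb n).
  by rewrite -mulrBl mulrA ler_pM2r ?invr_gt0.
have zc s : z n s / Fb n @[n --> \oo] --> weight s.
  rewrite -[weight s]add0r.
  have -> : (fun n => z n s / Fb n) = (fun n =>
      (z n s - mean_excess b n.+1 s) / Fb n + mean_excess b n.+1 s / Fb n).
    by apply/funext => n; rewrite -mulrDl subrK.
  apply: cvgD (@excess_ratio s).
  apply: (@cvgr0_norm_le _ _ (fun n =>
    B * (mean_excess b n.+1 s / Fb n - mean_excess b n.+2 s / Fb n))).
    move=> n; apply: le_trans (zb n s).
    by rewrite normrM (ger0_norm (x := (Fb n)^-1))// invr_ge0 ltW.
  have : B * (mean_excess b n.+1 s / Fb n - mean_excess b n.+2 s / Fb n)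
      @[n --> \oo] --> B * (weight s - weight s).
    by apply: cvgMr; apply: cvgB => //; exact: excess_ratio.
  by rewrite subrr mulr0.
have zK n s : `|z n s / Fb n| <= (1 + B) * K.
  have f0 : 0 <= (Fb n)^-1 by rewrite invr_ge0 ltW.
  have h := zb n s.
  have h1 := HK n s.
  have m2 : 0 <= mean_excess b n.+2 s / Fb n by rewrite mulr_ge0 ?mean_excess_ge0.
  have m1 : mean_excess b n.+1 s / Fb n <= K by apply: le_trans h1; exact: ler_norm.
  have : `|z n s / Fb n| <= `|z n s - mean_excess b n.+1 s| / Fb n + `|mean_excess b n.+1 s / Fb n|.
    rewrite -{2}(ger0_norm f0) -normrM.
    by apply: le_trans (ler_normD _ _); rewrite -mulrDl subrK.
  have : B * (mean_excess b n.+1 s / Fb n - mean_excess b n.+2 s / Fb n) <= B * K.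
    by rewrite ler_wpM2l//; lra.
  lra.
have W : rsum (fun s => piN n.+1 s * (z n s / Fb n)) @[n --> \oo] --> kappa.
  apply: (@rsum_weighted_cvg _ _ _ _ _ _ ((1 + B) * K)) => //.
  - by move=> n s; exact: stat_ge0 (piN_stat (ltn0Sn n)) s.
  - by move=> n; exact: stat_sum (piN_stat (ltn0Sn n)).
  - exact: stat_ge0 pi_stat.
  - exact: stat_sum pi_stat.
  - exact: piN_cvg.
(* The tail of [DI] at [n.+1] involves [total_excess n.+2], one index beyond
   [total_excess_ratio]. *)
have D : total_excess n.+2 / Fb n @[n --> \oo] --> kappa.
  exact: (@ratio_shift (fun n => total_excess n.+1) kappa total_excess_ratio).
have k0 := kappa_gt0.
have L : C * pi j * (rsum (fun s => piN n.+1 s * (z n s / Fb n)) / (total_excess n.+2 / Fb n))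
    @[n --> \oo] --> C * pi j * (kappa / kappa).
  apply: cvgMr; apply: cvgM => //; apply: cvgV => //; by rewrite gt_eqF.
rewrite divff ?gt_eqF// mulr1 in L.
apply: cvg_trans L; apply: near_eq_cvg; apply: nearW => n.
rewrite /= DI_tail /C mean_incrementE.
have sz : summ (fun s => piN n.+1 s * z n s).
  have qstat := piN_stat (ltn0Sn n).
  apply: (summ_stat qstat (M := (1 + B) * K * Fb n)) => s.
  have := zK n s; rewrite normrM (ger0_norm (x := (Fb n)^-1)); last first.
    by rewrite invr_ge0 ltW.
  by rewrite ler_pdivrMr.
have -> : rsum (fun s => piN n.+1 s * (z n s / Fb n)) =
    rsum (fun s => piN n.+1 s * z n s) / Fb n.
  by rewrite mulrC -rsumZ//; apply: eq_rsum => s; ring.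
have E := zE n.
have -> : piN n.+1 j - pi j = pi j / - sigma * rsum (fun s => piN n.+1 s * z n s).
  apply: (@mulfI _ (- sigma)); first by rewrite oppr_eq0 lt_eqF.
  by rewrite E; field; rewrite lt_eqF.
have t2 := total_excess_gt0 n.+2; have f0 := Fb_gt0 n.
field; rewrite ?oppr_eq0 ?(lt_eqF sigma_lt0) ?gt_eqF//.
Qed.

End Asymptotics.

Theorem corollary5p3 (R : realType) (M0 M1 : nat)
    (hM0 : (0 < M0)%N) (hM1 : (0 < M1)%N)
    (b : MG1_blocks R M0 M1)
    (P_stochastic : stochastic (MG1_matrix b))
    (P_irreducible : irreducible (MG1_matrix b))
    (A_stochastic : stochastic (sumA b))
    (A_irreducible : irreducible (sumA b))
    (varpi : 'rV[R]_M1)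
    (varpi_stationary : stationary_distribution (sumA b) (varpi ord0))
    (meanB_finite : forall i, (meanB b i < +oo)%E)
    (drift_lt0 : (drift b varpi < 0)%E)
    (F : nat -> R)
    (F_distribution : distribution_function F)
    (F_long_tailed : long_tailed F)
    (cA : 'cV[R]_M1) (cB : 'cV[R]_M0)
    (cA_ge0 : forall i, 0 <= cA i ord0)
    (cB_ge0 : forall i, 0 <= cB i ord0)
    (cAB_neq0 : cA != 0 \/ cB != 0)
    (tailA_lim : forall i,
      (tail2A b N *m ones R M1) i ord0 / (1 - F N) @[N --> \oo] --> cA i ord0)
    (tailB_lim : forall i,
      (tail2B b N *m ones R M1) i ord0 / (1 - F N) @[N --> \oo] --> cB i ord0)
    (pi : state M0 M1 -> R)
    (pi_stationary : stationary_distribution (MG1_matrix b) pi)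
    (piN : nat -> state M0 M1 -> R)
    (piN_stationary : forall N, (0 < N)%N ->
      stationary_distribution (MG1_matrix (LI_truncation N b)) (piN N)) :
  let DI := integrated_tail (increment_cdf b pi) in
  let C := fine (mean_increment b pi) / (- fine (drift b varpi)) in
  forall k : nat,
    (forall j : 'I_(phases M0 M1 k),
      ((level_vec (piN N) k - level_vec pi k) ord0 j / (1 - DI N)
         @[N --> \oo] --> (C *: level_vec pi k) ord0 j) /\
      0 < (C *: level_vec pi k) ord0 j) /\
    ((1 - DI N)^-1 *
       norm1 (((level_vec pi k *m ones R (phases M0 M1 k)) ord0 ord0)^-1 *:
              (level_vec (piN N) k - level_vec pi k))
       @[N --> \oo] --> C) /\
    0 < C.
Proof.
have pi_gt0 := stat_gt0 P_stochastic pi_stationary P_irreducible.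
move=> DI C k.
have C0 : 0 < C by apply: C_gt0; eassumption.
have lim (s : state M0 M1) :
    (piN N s - pi s) / (1 - DI N) @[N --> \oo] --> C * pi s.
  by apply: piN_asymptotics; eassumption.
have phases_gt0 : (0 < phases M0 M1 k)%N by case: (k).
have total : (level_vec pi k *m ones R (phases M0 M1 k)) ord0 ord0 =
    \sum_j pi (@mkstate M0 M1 k j).
  by rewrite mxE; apply: eq_bigr => j _; rewrite !mxE mulr1.
have total_gt0 : 0 < \sum_j pi (@mkstate M0 M1 k j).
  rewrite (bigD1 (Ordinal phases_gt0))//= ltr_pwDl// sumr_ge0// => j _.
  exact: ltW.
split; last split => //.
  move=> j; rewrite !mxE; split; last by rewrite mulr_gt0.
  under eq_fun do rewrite !mxE.
  exact: lim.
(* The sign allows the factor to enter the absolute values of [norm1]. *)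
have tail_ge0 N : 0 <= (1 - DI N)^-1.
  have t_gt0 n : 0 < total_excess b pi n by apply: total_excess_gt0; eassumption.
  have -> : 1 - DI N = total_excess b pi N.+1 / total_excess b pi 0.
    by apply: DI_tail; eassumption.
  by rewrite invr_ge0 divr_ge0// ltW.
set S := \sum_j _ in total total_gt0.
(* [C] is rewritten as the sum of the termwise limits, which are nonnegative and add up to C because
   [S] is the sum of the pi(j). *)
have -> : C = \sum_(j < phases M0 M1 k) `|S^-1 * (C * pi (@mkstate M0 M1 k j))|.
  rewrite (eq_bigr (fun j => C / S * pi (@mkstate M0 M1 k j))); last first.
    move=> j _; rewrite ger0_norm; first by ring.
    by apply: mulr_ge0; [rewrite invr_ge0|apply: mulr_ge0]; exact: ltW.
  by rewrite -mulr_sumr -/S divfK// gt_eqF.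
have E N : (1 - DI N)^-1 * norm1 (S^-1 *: (level_vec (piN N) k - level_vec pi k)) =
    \sum_(j < phases M0 M1 k)
      `|S^-1 * ((piN N (@mkstate M0 M1 k j) - pi (@mkstate M0 M1 k j)) / (1 - DI N))|.
  rewrite /norm1 mulr_sumr; apply: eq_bigr => j _.
  rewrite !mxE -{1}(ger0_norm (tail_ge0 N)) -normrM; congr `|_|.
  by rewrite mulrC mulrA.
rewrite total; under eq_fun do rewrite E.
apply: cvgr_sum => j; apply: (@cvg_norm _ R^o); apply: cvgMr; exact: lim.
Qed.
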